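(* Let $G$ be a finite group and $p$ a prime dividing $|G|$. Assume that Aschbacher's conjecture holds for the prime $p$. If $O_{p'}(\Omega_1(G)) < O_{p',p}(\Omega_1(G))$ (proper inclusion), then $\pi_1(\mathcal{A}_p(G))$ is free. In particular, $\pi_1(\mathcal{A}_p(G))$ is free if $G$ is $p$-solvable.
   Context: For a finite group $G$ and a prime $p$, $\mathcal{A}_p(G)$ is the poset of non-trivial elementary abelian $p$-subgroups of $G$ ordered by inclusion. Topological notions for a finite poset refer to the geometric realization of its order complex, whose simplices are the non-empty chains. If $\mathcal{A}_p(G)$ is disconnected, $\pi_1(\mathcal{A}_p(G))$ means the fundamental group of any connected component (they are all isomorphic, since $G$ permutes the components transitively by conjugation). $\Omega_1(G) = \langle x\in G : x^p = 1\rangle$; $O_p(G)$ is the largest normal $p$-subgroup of $G$; $O_{p'}(G)$ is the largest normal subgroup of $G$ of order prime to $p$; $O_{p',p}(G)$ is the unique normal subgroup of $G$ containing $O_{p'}(G)$ such that $O_{p',p}(G)/O_{p'}(G) = O_p(G/O_{p'}(G))$. Aschbacher's conjecture (for the prime $p$): Let $G$ be a finite group such that $G = AF^*(G)$, where $A$ is an elementary abelian $p$-subgroup of rank $r\geq 3$ and the generalized Fitting subgroup $F^*(G)$ is the direct product of the $A$-conjugates of a (non-abelian) simple component $L$ of $G$ of order prime to $p$. Then $\mathcal{A}_p(G)$ is simply connected. *)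

(* Defs.v *)
From HB Require Import structures.
From mathcomp Require Import all_boot all_order all_algebra all_fingroup.
From mathcomp Require Import all_solvable generic_quotient ring lra.
From mathcomp Require Import boolp classical_sets functions set_interval reals.
From mathcomp Require Import topology normedtype wedge_sigT continuous_path.

Set Implicit Arguments.
Unset Strict Implicit.
Unset Printing Implicit Defensive.

Import Order.TTheory GRing.Theory Num.Theory.
Import numFieldNormedType.Exports.

Local Open Scope classical_set_scope.
Local Open Scope ring_scope.
Local Open Scope quotient_scope.

Definition unit_interval (R : realType) : Type := set_type `[0 : R, 1 : R]%classic.

HB.instance Definition _ (R : realType) :=
  Topological.on (unit_interval R).

Section UnitInterval.
Variable R : realType.
Implicit Types (r : R) (t : unit_interval R).

Lemma unit_interval_bounds t : (0 <= \val t :> R) /\ (\val t <= 1 :> R).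
Proof. by have := set_valP t; rewrite /= in_itv /= => /andP. Qed.

Fact clamp_subproof r : Num.max 0 (Num.min r 1) \in `[0 : R, 1 : R]%classic.
Proof.
by rewrite inE /= in_itv /= le_max lexx /= ge_max ler01 ge_min lexx orbT.
Qed.

Definition clamp r : unit_interval R := SigSub (clamp_subproof r).

Lemma clampK r : 0 <= r <= 1 -> \val (clamp r) = r.
Proof. by case/andP=> r0 r1; rewrite /= min_l // max_r. Qed.

Lemma valK_clamp t : clamp (\val t) = t.
Proof. by apply: val_inj; rewrite clampK //; apply/andP/unit_interval_bounds. Qed.

Fact unit_interval_neq : clamp 0 != clamp 1.
Proof.
apply/eqP => /(congr1 \val); rewrite !clampK ?lexx ?ler01 // => /eqP.
by rewrite eq_sym oner_eq0.
Qed.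

HB.instance Definition _ :=
  isBiPointed.Build (unit_interval R) unit_interval_neq.

Lemma val_zero : \val (zero : unit_interval R) = 0 :> R.
Proof. by rewrite clampK ?lexx ?ler01. Qed.

Lemma val_one : \val (one : unit_interval R) = 1 :> R.
Proof. by rewrite clampK ?lexx ?ler01. Qed.

Lemma val_continuous : continuous (\val : unit_interval R -> R).
Proof. exact: initial_continuous. Qed.

Lemma clamp_continuous : continuous clamp.
Proof.
apply: continuous_comp_initial => x.
rewrite (_ : _ \o _ = (cst 0 : R -> R^o) \max ((id : R -> R^o) \min cst 1)) //.
apply: continuous_max; first exact: cvg_cst.
by apply: continuous_min; [exact: cvg_id | exact: cvg_cst].
Qed.

End UnitInterval.

Definition cts_real (R : realType) (X : topologicalType) (a : X -> R) : Prop :=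
  continuous a.

Lemma glue_continuous (R : realType) (X T : topologicalType) (c : R)
    (phi : X -> R) (g h : X -> T) :
    cts_real phi -> continuous g -> continuous h ->
    (forall x, phi x = c -> g x = h x) ->
  continuous (fun x => if phi x <= c then g x else h x).
Proof.
move=> cphi cg ch gh; apply/continuous_subspace_setT.
rewrite (_ : setT = phi @^-1` [set r | r <= c] `|` phi @^-1` [set r | c <= r]).
  apply: withinU_continuous.
  - by move/continuous_closedP: cphi; apply; exact: closed_le.
  - by move/continuous_closedP: cphi; apply; exact: closed_ge.
  - apply: (@subspace_eq_continuous _ _ _ g); last exact: continuous_subspaceT.
    by move=> x; rewrite inE /from_subspace /= => ->.
  - apply: (@subspace_eq_continuous _ _ _ h); last exact: continuous_subspaceT.
    move=> x; rewrite inE /from_subspace /= => cx; case: ifPn => // xc.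
    by apply/esym/gh/eqP; rewrite eq_le xc.
by apply/seteqP; split=> x //= _; apply/orP; exact: le_total.
Qed.

Section PathHomotopy.
Variables (R : realType) (T : topologicalType).
Local Notation I := (unit_interval R).
Implicit Types (f g h : I -> T).

(* Homotopy relative to the endpoints. *)
Definition path_homotopic f g : Prop :=
  exists H : I * I -> T,
    [/\ continuous H, forall t, H (zero, t) = f t, forall t, H (one, t) = g t,
        forall s, H (s, zero) = f zero & forall s, H (s, one) = f one].

Definition path_cat f g : I -> T := fun t =>
  if (\val t : R) <= 2^-1 then f (clamp (2 * \val t))
  else g (clamp (2 * \val t - 1)).

Definition path_rev f : I -> T := fun t => f (clamp (1 - \val t)).

Lemma continuous_clamp2 (X : topologicalType) (a b : X -> R) (H : I * I -> T) :
    cts_real a -> cts_real b -> continuous H ->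
  continuous (fun x => H (clamp (a x), clamp (b x))).
Proof.
move=> ca cb cH x.
have clampc (c : X -> R) : continuous c -> clamp (c y) @[y --> x] --> clamp (c x).
  by move=> cc; apply: (continuous_comp (cc x)); exact: clamp_continuous.
apply: (@continuous_comp _ _ _ (fun x => (clamp (a x), clamp (b x))) H).
  exact: cvg_pair (clampc _ ca) (clampc _ cb).
exact: cH.
Qed.

Lemma continuous_clamp (X : topologicalType) (a : X -> R) f :
  cts_real a -> continuous f -> continuous (fun x => f (clamp (a x))).
Proof.
move=> ca cf x; apply: (@continuous_comp _ _ _ (fun x => clamp (a x)) f).
  by apply: (continuous_comp (ca x)); exact: clamp_continuous.
exact: cf.
Qed.

Lemma val1_continuous : cts_real (fun z : I * I => \val z.1 : R).
Proof.
by move=> z; apply: continuous_comp; [exact: cvg_fst | exact: val_continuous].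
Qed.

Lemma val2_continuous : cts_real (fun z : I * I => \val z.2 : R).
Proof.
by move=> z; apply: continuous_comp; [exact: cvg_snd | exact: val_continuous].
Qed.

Lemma cst_cts (X : topologicalType) (c : R) : cts_real (fun _ : X => c).
Proof. by move=> x; exact: cvg_cst. Qed.

Lemma addf_cts (X : topologicalType) (a b : X -> R) :
  cts_real a -> cts_real b -> cts_real (fun x => a x + b x).
Proof. by move=> ca cb x; apply: cvgD; [exact: ca | exact: cb]. Qed.

Lemma oppf_cts (X : topologicalType) (a : X -> R) :
  cts_real a -> cts_real (fun x => - a x).
Proof. by move=> ca x; apply: cvgN; exact: ca. Qed.

Lemma mulf_cts (X : topologicalType) (a b : X -> R) :
  cts_real a -> cts_real b -> cts_real (fun x => a x * b x).
Proof. by move=> ca cb x; apply: cvgM; [exact: ca | exact: cb]. Qed.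

Lemma minf_cts (X : topologicalType) (a b : X -> R) :
  cts_real a -> cts_real b -> cts_real (fun x => Num.min (a x) (b x)).
Proof. by move=> ca cb x; exact: (@continuous_min R X a b x (ca x) (cb x)). Qed.

Lemma normf_cts (X : topologicalType) (a : X -> R) :
  cts_real a -> cts_real (fun x => `|a x|).
Proof. by move=> ca x; apply: cvg_norm; exact: ca. Qed.

End PathHomotopy.

Ltac cts := lazymatch goal with
  | |- cts_real (fun x => GRing.add (@?a x) (@?b x)) =>
      apply: (@addf_cts _ _ a b); cts
  | |- cts_real (fun x => GRing.mul (@?a x) (@?b x)) =>
      apply: (@mulf_cts _ _ a b); cts
  | |- cts_real (fun x => GRing.opp (@?a x)) => apply: (@oppf_cts _ _ a); cts
  | |- cts_real (fun x => Order.min (@?a x) (@?b x)) =>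
      apply: (@minf_cts _ _ a b); cts
  | |- cts_real (fun x => Num.norm (@?a x)) => apply: (@normf_cts _ _ a); cts
  | |- _ => first [ assumption | exact: val1_continuous | exact: val2_continuous
                  | exact: val_continuous | exact: cst_cts ]
  end.

Section PathHomotopyTheory.
Variables (R : realType) (T : topologicalType).
Local Notation I := (unit_interval R).
Implicit Types (f g h : I -> T) (phi psi : I -> R).

Let clamp0 : clamp 0 = zero :> I. Proof. by []. Qed.
Let clamp1 : clamp 1 = one :> I. Proof. by []. Qed.

Lemma path_homotopic_eq f g : continuous f -> f =1 g -> path_homotopic f g.
Proof.
move=> cf fg; exists (fun z => f z.2); split=> //.
by move=> z; apply: continuous_comp; [exact: cvg_snd | exact: cf].
Qed.

Lemma path_homotopic_refl f : continuous f -> path_homotopic f f.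
Proof. by move=> cf; exact: path_homotopic_eq. Qed.

Lemma path_homotopic_ends f g :
  path_homotopic f g -> f zero = g zero /\ f one = g one.
Proof. by case=> H [_ _ H1 Hz Ho]; rewrite -!H1 Hz Ho. Qed.

Lemma path_homotopic_sym f g : path_homotopic f g -> path_homotopic g f.
Proof.
move=> fg; have [e0 e1] := path_homotopic_ends fg.
case: fg => H [cH H0 H1 Hz Ho].
exists (fun z => H (clamp (1 - \val z.1), clamp (\val z.2))); split.
- by apply: continuous_clamp2; cts.
- by move=> t; rewrite val_zero subr0 valK_clamp clamp1 H1.
- by move=> t; rewrite val_one subrr valK_clamp clamp0 H0.
- by move=> s; rewrite valK_clamp Hz.
- by move=> s; rewrite valK_clamp Ho.
Qed.

Lemma path_homotopic_trans f g h :
  path_homotopic f g -> path_homotopic g h -> path_homotopic f h.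
Proof.
move=> fg; have [e0 e1] := path_homotopic_ends fg.
case: fg => H [cH H0 H1 Hz Ho] [K [cK K0 K1 Kz Ko]].
exists (fun z => if \val z.1 <= 2^-1 :> R
  then H (clamp (2 * \val z.1), clamp (\val z.2))
  else K (clamp (2 * \val z.1 - 1), clamp (\val z.2))); split.
- apply: glue_continuous; try (by apply: continuous_clamp2; cts); first by cts.
  move=> z ->; rewrite divff ?subrr ?pnatr_eq0 // valK_clamp.
  by rewrite clamp0 clamp1 H1 K0.
- by move=> t; rewrite val_zero invr_ge0 ler0n mulr0 valK_clamp clamp0 H0.
- move=> t; rewrite val_one ifF; last by apply/negbTE; rewrite -ltNge; lra.
  by rewrite (_ : 2 * 1 - 1 = 1); [rewrite valK_clamp clamp1 K1 | ring].
- by move=> s; rewrite !valK_clamp Hz Kz -e0; case: ifP.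
- by move=> s; rewrite !valK_clamp Ho Ko -e1; case: ifP.
Qed.

Lemma path_cat_continuous f g : continuous f -> continuous g ->
  f one = g zero -> continuous (path_cat f g).
Proof.
move=> cf cg fg; apply: glue_continuous; first by cts.
- by apply: continuous_clamp; cts.
- by apply: continuous_clamp; cts.
- by move=> t ->; rewrite divff ?subrr ?pnatr_eq0.
Qed.

Lemma path_rev_continuous f : continuous f -> continuous (path_rev f).
Proof. by move=> cf; apply: continuous_clamp; cts. Qed.

Lemma path_cat_zero f g : path_cat f g zero = f zero.
Proof. by rewrite /path_cat val_zero invr_ge0 ler0n mulr0. Qed.

Lemma path_cat_one f g : path_cat f g one = g one.
Proof.
rewrite /path_cat val_one ifF; last by apply/negbTE; rewrite -ltNge; lra.
by rewrite (_ : 2 * 1 - 1 = 1); last ring.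
Qed.

Lemma path_rev_zero f : path_rev f zero = f one.
Proof. by rewrite /path_rev val_zero subr0. Qed.

Lemma path_rev_one f : path_rev f one = f zero.
Proof. by rewrite /path_rev val_one subrr. Qed.

Lemma path_homotopic_cat f f' g g' : f one = g zero ->
  path_homotopic f f' -> path_homotopic g g' ->
  path_homotopic (path_cat f g) (path_cat f' g').
Proof.
move=> fg [H [cH H0 H1 Hz Ho]] [K [cK K0 K1 Kz Ko]].
exists (fun z => if \val z.2 <= 2^-1 :> R
  then H (clamp (\val z.1), clamp (2 * \val z.2))
  else K (clamp (\val z.1), clamp (2 * \val z.2 - 1))); split.
- apply: glue_continuous; try (by apply: continuous_clamp2; cts); first by cts.
  move=> z ->; rewrite divff ?subrr ?pnatr_eq0 // valK_clamp.
  by rewrite clamp0 clamp1 Ho Kz.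
- by move=> t; rewrite valK_clamp H0 K0.
- by move=> t; rewrite valK_clamp H1 K1.
- by move=> s; rewrite valK_clamp path_cat_zero val_zero invr_ge0 ler0n mulr0 Hz.
- move=> s; rewrite valK_clamp path_cat_one val_one ifF.
    by rewrite (_ : 2 * 1 - 1 = 1); [rewrite clamp1 Ko | ring].
  by apply/negbTE; rewrite -ltNge; lra.
Qed.

Lemma path_homotopic_rev f f' :
  path_homotopic f f' -> path_homotopic (path_rev f) (path_rev f').
Proof.
case=> H [cH H0 H1 Hz Ho].
exists (fun z => H (clamp (\val z.1), clamp (1 - \val z.2))); split.
- by apply: continuous_clamp2; cts.
- by move=> t; rewrite valK_clamp H0.
- by move=> t; rewrite valK_clamp H1.
- by move=> s; rewrite valK_clamp path_rev_zero val_zero subr0 clamp1 Ho.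
- by move=> s; rewrite valK_clamp path_rev_one val_one subrr clamp0 Hz.
Qed.

Lemma path_homotopic_reparam f phi psi :
    continuous f -> cts_real phi -> cts_real psi ->
    phi zero = psi zero -> phi one = psi one ->
  path_homotopic (fun t => f (clamp (phi t))) (fun t => f (clamp (psi t))).
Proof.
move=> cf cphi cpsi e0 e1.
exists (fun z => f (clamp ((1 - \val z.1) * phi z.2 + \val z.1 * psi z.2))).
have c2 (a : I -> R) : cts_real a -> cts_real (fun z : I * I => a z.2).
  by move=> ca z; apply: continuous_comp; [exact: cvg_snd | exact: ca].
have cphi2 := c2 _ cphi; have cpsi2 := c2 _ cpsi.
split.
- by apply: continuous_clamp; cts.
- by move=> t; rewrite val_zero subr0 mul1r mul0r addr0.
- by move=> t; rewrite val_one subrr mul1r mul0r add0r.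
- by move=> s; rewrite /= -e0 -mulrDl subrK mul1r.
- by move=> s; rewrite /= -e1 -mulrDl subrK mul1r.
Qed.

Lemma path_catA f g h :
    continuous f -> continuous g -> continuous h ->
    f one = g zero -> g one = h zero ->
  path_homotopic (path_cat f (path_cat g h)) (path_cat (path_cat f g) h).
Proof.
move=> cf cg ch fg gh.
have cgh := path_cat_continuous cg ch gh.
have cfgh : continuous (path_cat f (path_cat g h)).
  by apply: path_cat_continuous; rewrite ?path_cat_zero.
pose phi (t : I) := Num.min (2 * \val t)
  (Num.min (\val t + 4^-1) (2^-1 * \val t + 2^-1)) : R.
have cphi : cts_real phi.
  by rewrite /phi; cts.
apply: path_homotopic_trans (path_homotopic_trans
  (@path_homotopic_reparam (path_cat f (path_cat g h)) \val phi cfgh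
     (@val_continuous R) cphi _ _) _).
- by apply: path_homotopic_eq => // t; rewrite valK_clamp.
- by rewrite /phi val_zero min_l ?mulr0 // le_min; apply/andP; split; lra.
- by rewrite /phi val_one (@min_r _ _ (_ + _)) ?min_r; lra.
apply: path_homotopic_eq; first by apply: continuous_clamp.
move=> t; have [t0 t1] := unit_interval_bounds t; rewrite /path_cat.
have F (a b : R) : b < a -> (a <= b) = false by move=> ba; rewrite leNgt ba.
have K (a : R) : 0 <= a -> a <= 1 -> \val (clamp a) = a.
  by move=> a0 a1; rewrite clampK // a0.
have [t4|t4] := leP (\val t : R) 4^-1.
  have -> : phi t = 2 * \val t.
    by rewrite /phi min_l // le_min; apply/andP; split; lra.
  have -> : (\val t <= 2^-1 :> R) = true by lra.
  rewrite (K (2 * \val t)); [|lra|lra].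
  by have -> : (2 * \val t <= 2^-1 :> R) = true by lra.
have [t2|t2] := leP (\val t : R) 2^-1.
  have -> : phi t = \val t + 4^-1.
    by rewrite /phi (@min_l _ _ (_ + _)) ?min_r //; lra.
  rewrite (K (2 * \val t)); [|lra|lra].
  rewrite (K (\val t + 4^-1)); [|lra|lra].
  rewrite (F (\val t + 4^-1)); last lra.
  rewrite (F (2 * \val t)); last lra.
  rewrite K; [|lra|lra].
  have -> : (2 * (\val t + 4^-1) - 1 <= 2^-1 :> R) = true by lra.
  by congr (g (clamp _)); field.
have -> : phi t = 2^-1 * \val t + 2^-1.
  by rewrite /phi (@min_r _ _ (_ + _)) ?min_r //; lra.
rewrite (K (2^-1 * _ + _)); [|lra|lra].
rewrite (F (2^-1 * _ + _)); last lra.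
rewrite K; [|lra|lra].
rewrite F; last lra.
by congr (h (clamp _)); field.
Qed.

Lemma clamp_le0 (r : R) : r <= 0 -> clamp r = zero :> I.
Proof.
by move=> r0; apply: val_inj; rewrite val_zero /= max_l // ge_min r0.
Qed.

Lemma clamp_ge1 (r : R) : 1 <= r -> clamp r = one :> I.
Proof. by move=> r1; apply: val_inj; rewrite val_one /= min_r // max_r. Qed.

Lemma path_homotopic_id f phi :
    continuous f -> cts_real phi -> phi zero <= 0 -> 1 <= phi one ->
  path_homotopic (fun t => f (clamp (phi t))) f.
Proof.
move=> cf cphi e0 e1.
have cvphi : cts_real (fun t => \val (clamp (phi t))).
  by apply: continuous_clamp => //; exact: val_continuous.
have z0 : \val (clamp (phi zero) : I) = \val (zero : I) by rewrite clamp_le0.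
have z1 : \val (clamp (phi one) : I) = \val (one : I) by rewrite clamp_ge1.
have := path_homotopic_reparam cf cvphi (@val_continuous R) z0 z1.
under eq_fun do rewrite valK_clamp.
by under [X in path_homotopic _ X]eq_fun do rewrite valK_clamp.
Qed.

Lemma path_homotopic_cst f phi :
    continuous f -> cts_real phi -> phi zero = phi one ->
  path_homotopic (fun t => f (clamp (phi t))) (cst (f (clamp (phi zero)))).
Proof.
move=> cf cphi e.
by apply: (path_homotopic_reparam (psi := cst (phi zero))) => //; exact: cst_cts.
Qed.

Lemma path_cat1p f x : continuous f -> f zero = x ->
  path_homotopic (path_cat (cst x) f) f.
Proof.
move=> cf fx.
rewrite (_ : path_cat _ _ = fun t => f (clamp (2 * \val t - 1))).
  apply: path_homotopic_id => //; first by cts.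
    by rewrite val_zero; lra.
  by rewrite val_one; lra.
apply/funext => t; rewrite /path_cat; case: ifPn => // t2.
have t0 : 2 * \val t - 1 <= 0 :> R by lra.
by rewrite (clamp_le0 t0) fx.
Qed.

Lemma path_catp1 f x : continuous f -> f one = x ->
  path_homotopic (path_cat f (cst x)) f.
Proof.
move=> cf fx.
rewrite (_ : path_cat _ _ = fun t => f (clamp (2 * \val t))).
  apply: path_homotopic_id => //; first by cts.
    by rewrite val_zero; lra.
  by rewrite val_one; lra.
apply/funext => t; rewrite /path_cat; case: ifPn => // t2.
have t1 : 1 <= 2 * \val t :> R by rewrite -ltNge in t2; lra.
by rewrite (clamp_ge1 t1) fx.
Qed.

Lemma path_catVp f x : continuous f -> f one = x ->
  path_homotopic (path_cat (path_rev f) f) (cst x).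
Proof.
move=> cf fx; pose phi (t : I) := `|1 - 2 * \val t| : R.
have cphi : cts_real phi by rewrite /phi; cts.
have p0 : phi zero = 1 by rewrite /phi val_zero mulr0 subr0 normr1.
have p1 : phi one = 1 by rewrite /phi val_one ler0_norm; lra.
rewrite (_ : path_cat _ _ = fun t => f (clamp (phi t))).
  by rewrite -fx -clamp1 -p0; apply: path_homotopic_cst; rewrite ?p0.
apply/funext => t; have [t0 t1] := unit_interval_bounds t.
rewrite /path_cat /path_rev /phi; case: ifPn => t2.
  by rewrite ger0_norm ?clampK //; try apply/andP; try split; lra.
by rewrite ltr0_norm ?opprB //; lra.
Qed.

Lemma path_catpV f x : continuous f -> f zero = x ->
  path_homotopic (path_cat f (path_rev f)) (cst x).
Proof.
move=> cf fx; pose phi (t : I) := 1 - `|1 - 2 * \val t| : R.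
have cphi : cts_real phi by rewrite /phi; cts.
have p0 : phi zero = 0 by rewrite /phi val_zero mulr0 subr0 normr1 subrr.
have p1 : phi one = 0 by rewrite /phi val_one ler0_norm; lra.
rewrite (_ : path_cat _ _ = fun t => f (clamp (phi t))).
  by rewrite -fx -clamp0 -p0; apply: path_homotopic_cst; rewrite ?p0.
apply/funext => t; have [t0 t1] := unit_interval_bounds t.
rewrite /path_cat /path_rev /phi; case: ifPn => t2.
  by rewrite ger0_norm; [congr (f (clamp _)); ring | lra].
rewrite ltr0_norm; last lra.
by rewrite clampK; [congr (f (clamp _)); ring | apply/andP; split; lra].
Qed.

End PathHomotopyTheory.

Section FundamentalGroup.
Variables (R : realType) (T : topologicalType) (x : T).

Local Notation loop := {path unit_interval R from x to x in T}.

Implicit Types f g h : loop.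

Let loop_match f g : (f : _ -> T) one = (g : _ -> T) zero.
Proof. by rewrite path_zero path_one. Qed.

Let loop_cat_zero f g : path_cat f g zero = x.
Proof. by rewrite path_cat_zero path_zero. Qed.

Let loop_cat_one f g : path_cat f g one = x.
Proof. by rewrite path_cat_one path_one. Qed.

Let loop_rev_zero f : path_rev f zero = x.
Proof. by rewrite path_rev_zero path_one. Qed.

Let loop_rev_one f : path_rev f one = x.
Proof. by rewrite path_rev_one path_zero. Qed.

Definition loop_cat f g : loop :=
  mk_path (path_cat_continuous (@cts_fun _ _ f) (@cts_fun _ _ g)
             (loop_match f g)) (loop_cat_zero f g) (loop_cat_one f g).

Definition loop_rev f : loop :=
  mk_path (path_rev_continuous (@cts_fun _ _ f))
    (loop_rev_zero f) (loop_rev_one f).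

Definition loop_cst : loop := cst x.

Definition loop_homotopic f g : bool := `[< path_homotopic f g >].

Fact loop_homotopic_equiv : equiv_class_of loop_homotopic.
Proof.
split.
- by move=> f; apply/asboolP/path_homotopic_refl; exact: cts_fun.
- by move=> f g; apply/asboolP/asboolP; exact: path_homotopic_sym.
- move=> f g h /asboolP gf /asboolP fh.
  by apply/asboolP; exact: path_homotopic_trans gf fh.
Qed.

Canonical loop_homotopic_rel := EquivRelPack loop_homotopic_equiv.

Definition fundamental_group := {eq_quot loop_homotopic_rel}.

HB.instance Definition _ := Choice.on fundamental_group.
HB.instance Definition _ : EqQuotient _ loop_homotopic_rel fundamental_group :=
  EqQuotient.on fundamental_group.

Local Notation pi1 := fundamental_group.

Definition pi1_one : pi1 := \pi_pi1 loop_cst.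
Definition pi1_mul (a b : pi1) : pi1 := \pi_pi1 (loop_cat (repr a) (repr b)).
Definition pi1_inv (a : pi1) : pi1 := \pi_pi1 (loop_rev (repr a)).

Lemma pi1_eqP f g : \pi_pi1 f = \pi_pi1 g <-> path_homotopic f g.
Proof.
by split=> [/eqmodP/asboolP | fg] //; apply/eqmodP/asboolP.
Qed.

Lemma repr_pi f : path_homotopic (repr (\pi_pi1 f)) f.
Proof. by apply/pi1_eqP; rewrite reprK. Qed.

Lemma pi1_mulE f g : pi1_mul (\pi_pi1 f) (\pi_pi1 g) = \pi_pi1 (loop_cat f g).
Proof.
apply/pi1_eqP; apply: path_homotopic_cat; [|exact: repr_pi|exact: repr_pi].
exact: loop_match.
Qed.

Lemma pi1_invE f : pi1_inv (\pi_pi1 f) = \pi_pi1 (loop_rev f).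
Proof. by apply/pi1_eqP; apply: path_homotopic_rev; exact: repr_pi. Qed.

Fact pi1_mulA : associative pi1_mul.
Proof.
elim/quotW=> f; elim/quotW=> g; elim/quotW=> h.
rewrite (pi1_mulE g h) (pi1_mulE f g) (pi1_mulE f) (pi1_mulE _ h).
apply/pi1_eqP.
exact: (path_catA (@cts_fun _ _ f) (@cts_fun _ _ g) (@cts_fun _ _ h)
  (loop_match f g) (loop_match g h)).
Qed.

Fact pi1_mul1 : left_id pi1_one pi1_mul.
Proof.
elim/quotW=> f; rewrite pi1_mulE; apply/pi1_eqP.
exact: (path_cat1p (@cts_fun _ _ f) path_zero).
Qed.

Fact pi1_mulr1 : right_id pi1_one pi1_mul.
Proof.
elim/quotW=> f; rewrite pi1_mulE; apply/pi1_eqP.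
exact: (path_catp1 (@cts_fun _ _ f) path_one).
Qed.

Fact pi1_mulV : left_inverse pi1_one pi1_inv pi1_mul.
Proof.
elim/quotW=> f; rewrite pi1_invE pi1_mulE; apply/pi1_eqP.
exact: (path_catVp (@cts_fun _ _ f) path_one).
Qed.

Fact pi1_mulrV : right_inverse pi1_one pi1_inv pi1_mul.
Proof.
elim/quotW=> f; rewrite pi1_invE pi1_mulE; apply/pi1_eqP.
exact: (path_catpV (@cts_fun _ _ f) path_zero).
Qed.

HB.instance Definition _ := isGroup.Build fundamental_group
  pi1_mulA pi1_mul1 pi1_mulr1 pi1_mulV pi1_mulrV.

End FundamentalGroup.

Definition path_connected (R : realType) (T : topologicalType) : Prop :=
  forall x y : T, inhabited {path unit_interval R from x to y in T}.

Definition simply_connected (R : realType) (T : topologicalType) : Prop :=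
  [/\ inhabited T, path_connected R T
    & forall (x : T) (a : fundamental_group R x), a = 1%g].

(* Freeness by the universal property of a basis S. *)
Definition free_group (G : groupType) : Prop :=
  exists S : set G, forall (H : groupType) (u : G -> H),
    exists! phi : G -> H,
      {morph phi : a b / (a * b)%g} /\ (forall a, S a -> phi a = u a).

Definition order_complex (V : finType) (le : rel V) (P : {set V}) :
    {set {set V}} :=
  [set s : {set V} | [&& s != finset.set0, s \subset P &
    [forall v in s, forall w in s, le v w || le w v]]]%SET.

(* Points are given by their barycentric coordinates. *)
Definition realization (R : realType) (V : finType) (K : {set {set V}}) :
    set {ptws V -> R} :=
  [set t | [/\ forall v, 0 <= t v, \sum_v t v = 1
             & [set v | t v != 0]%SET \in K]].
Arguments realization R {V} K.

Local Close Scope classical_set_scope.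
Local Close Scope ring_scope.
Local Open Scope group_scope.

Section GroupTheory.
Variable gT : finGroupType.
Implicit Types (p : nat) (G L : {group gT}).

Definition Ap p G : {set {group gT}} := 'E_p(G) :\ 1%G.

Definition Ap_space (R : realType) p G : topologicalType :=
  realization R (order_complex (fun A B : {group gT} => A \subset B) (Ap p G)).

(* This is not 'Ohm_1(G), which is generated by the elements of any prime *)
(* order; the two agree when G is a p-group. *)
Definition Omega1 p G := <<'Ldiv_p(G)>>.
Canonical Omega1_group p G := [group of Omega1 p G].

Definition p_solvable p G : Prop :=
  exists2 s : seq {group gT}, last G s = 1%G &
    path (fun H K : {group gT} =>
      (K <| H) && (p.-group (H / K) || p^'.-group (H / K))) G s.

Definition quasisimple L := (L^`(1) == L) && simple (L / 'Z(L)).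

Definition component L G := (L <|<| G) && quasisimple L.

Definition gen_Fitting G :=
  'F(G) <*> \bigcup_(L : {group gT} | component L G) L.
Canonical gen_Fitting_group G := [group of gen_Fitting G].

End GroupTheory.

Definition aschbacher_conjecture (R : realType) (p : nat) : Prop :=
  forall (gT : finGroupType) (G A L : {group gT}),
    A \subset G -> p.-abelem A -> (3 <= 'r(A))%N ->
    component L G -> simple L -> ~~ abelian L -> coprime p #|L| ->
    \big[dprod/1]_(H in L :^: A) H = gen_Fitting G ->
    A * gen_Fitting G = G ->
  simply_connected R (Ap_space R p G).

(* Main.v *)
(** Homomorphisms from the fundamental group of a simplicial complex to a group
    H correspond, through holonomy along paths, to H-valued cocycles on the
    edges, so that everything is phrased in terms of cocycles. Replace G by
    W = Omega_1(G), which has the same poset X of nontrivial elementary abelian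
    p-subgroups, let N = O_p'(W), and let Y be the poset of W / N.

    If every cocycle on X is a coboundary on the subgroups of rank at least 2,
    then up to a change of gauge a cocycle is a choice of one value for each
    pair of a subgroup A of order p and a component of the elements of X above
    A. Hence one cocycle with values in a free group is universal, the
    fundamental group embeds in that free group, and it is free by
    Nielsen-Schreier.

    To prove that cocycles on X are coboundaries in rank at least 2, map X to Y.
    Cocycles on Y are coboundaries because O_p(W / N) is nontrivial (Quillen).
    The fibre below AN / N is the poset of NA: it is connected when A has rank
    at least 2, by coprime generation, and has only trivial cocycles when A has
    rank at least 3. The latter follows by induction on N: one may take N
    minimal normal in NA with C_A(N) = 1; then N is not abelian since A is not
    cyclic, and this is the case covered by Aschbacher's conjecture. *)

Require Import Defs.
From HB Require Import structures.
From mathcomp Require Import all_boot all_order all_algebra all_fingroup.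
From mathcomp Require Import all_solvable mxrepresentation mxabelem.
From mathcomp Require Import generic_quotient ring lra.
From mathcomp Require Import boolp classical_sets functions reals.
From mathcomp Require Import topology normedtype continuous_path.
From mathcomp Require Import fintype finset.

Set Implicit Arguments.
Unset Strict Implicit.
Unset Printing Implicit Defensive.

Import Order.TTheory GRing.Theory Num.Theory.
Import numFieldNormedType.Exports.

(** The group in question is defined by continuous loops, so combinatorial data must be tied to
    topology in both directions. A cocycle yields an invariant of loops, its holonomy; conversely,
    one cocycle takes its values in the fundamental group itself and has the class of a loop as
    holonomy, up to a fixed conjugation. Together these replace covering spaces and edge-path
    presentations. Admitting nonabelian groups of values makes triviality of all cocycles as strong
    as simple connectivity of the components, while potentials can be glued without base points.

    The number 3 arises as follows. On subgroups of rank at least 2, only strict inclusions need a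
    comparison, and the larger member then has rank at least 3. For rank 2 the poset of [NA] is only
    a graph, which may have cycles; this is why the conclusion is freeness and not simple
    connectivity. In the induction on [N], however, triviality is needed on the whole poset of [NA],
    including subgroups of order [p]. There the elements above such a subgroup form a connected
    poset, again because [A] has rank at least 3, and this lets the potential extend. *)

(** * Holonomy of cocycles *)

Section IntervalInduction.
Local Open Scope classical_set_scope.
Local Open Scope ring_scope.
Variable R : realType.

(** Compactness of the interval: the supremum of the points [t] with [Q x t] can always be passed
    unless it is [y]. Taking [Q] as a relation between two times lets it be an existence statement,
    an equality of values or an implication. *)
Lemma interval_induction (Q : R -> R -> Prop) (x y : R) : x <= y ->
    (forall a m b, x <= a -> a <= m -> m <= b -> b <= y ->
       Q a m -> Q m b -> Q a b) ->
    (forall t, x <= t <= y -> exists2 d, 0 < d &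
       forall a b, x <= a -> a <= b -> b <= y ->
         `|a - t| < d -> `|b - t| < d -> Q a b) ->
  Q x y.
Proof.
move=> xy Qcat Qloc.
pose A := [set t | x <= t <= y /\ Q x t].
have Ax : A x.
  have [|d d0 Qd] := Qloc x; first by rewrite lexx.
  by split; [rewrite lexx | apply: Qd; rewrite ?subrr ?normr0].
have ubA : ubound A y by move=> t [/andP[]].
have hsA : has_sup A by split; [exists x | exists y].
pose s := sup A.
have xs : x <= s by apply: ub_le_sup => //; exists y.
have sy : s <= y by apply: ge_sup => //; exists x.
have [|d d0 Qd] := Qloc s; first by rewrite xs sy.
have [t At ts] := sup_adherent d0 hsA.
have ts' : t <= s by apply: ub_le_sup => //; exists y.
case: At => /andP[xt ty] Qt.
have Qb b : s <= b -> b <= y -> b < s + d -> Q x b.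
  move=> sb bby bd; apply: Qcat Qt _ => //; first exact: le_trans sb.
  apply: Qd => //; first exact: le_trans sb.
    by rewrite ltr_norml; apply/andP; split; rewrite /s in ts ts' *; lra.
  by rewrite ger0_norm; lra.
have [->|sny] := eqVneq y s.
  by apply: Qb => //; lra.
have sy' : s < y by rewrite lt_neqAle eq_sym sny sy.
pose b := Num.min y (s + d / 2).
have sb : s < b by rewrite lt_min sy'; lra.
have bby : b <= y by rewrite ge_min lexx.
suff /ub_le_sup : A b by move=> /(_ (ex_intro _ y ubA)); rewrite -/s leNgt sb.
split; first by rewrite bby (le_trans xs (ltW sb)).
apply: Qb => //; first exact: ltW.
by rewrite gt_min; apply/orP; right; lra.
Qed.

End IntervalInduction.

Section Realization.
Local Open Scope classical_set_scope.
Local Open Scope ring_scope.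
Variables (R : realType) (V : finType) (K : {set {set V}}).

Local Notation T := (realization R K : topologicalType).
Local Notation I := (unit_interval R).

Definition support (x : T) : {set V} := [set v | (\val x : V -> R) v != 0]%SET.

Lemma coord_ge0 (x : T) v : 0 <= (\val x : V -> R) v.
Proof. by have [] := set_valP x. Qed.

Lemma supportE (x : T) v : (v \in support x) = (0 < (\val x : V -> R) v).
Proof. by rewrite inE lt0r coord_ge0 andbT. Qed.

Lemma support_in (x : T) : support x \in K.
Proof. by have [] := set_valP x. Qed.

Lemma support_neq0 (x : T) : exists v, v \in support x.
Proof.
have [_ xs _] := set_valP x; apply/existsP; apply/contraT => /existsPn s0.
move: xs; rewrite big1 => [/eqP|v _]; first by rewrite eq_sym oner_eq0.
by apply/eqP; have := s0 v; rewrite inE negbK.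
Qed.

Lemma coord_continuous v : cts_real (fun x : T => (\val x : V -> R) v).
Proof.
move=> x; apply: (@continuous_comp _ _ _ (\val : T -> {ptws V -> R})
  (fun f : {ptws V -> R} => f v)).
  exact: initial_continuous.
exact: (@proj_continuous V (fun=> R) v).
Qed.

(** Open stars of vertices are open: a positive coordinate stays positive nearby. *)
Lemma support_near (X : topologicalType) (f : X -> T) x v :
    {for x, continuous f} ->
  v \in support (f x) -> \forall y \near x, v \in support (f y).
Proof.
move=> cf; rewrite supportE => fxv.
have cfv : (\val (f y) : V -> R) v @[y --> x] --> (\val (f x) : V -> R) v.
  apply: (@continuous_comp _ _ _ f (fun x : T => (\val x : V -> R) v)) => //.
  exact: coord_continuous.
by apply: filterS (cvgr_gt _ cfv _ fxv) => y; rewrite supportE.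
Qed.

Lemma support_nearR (f : R -> T) t v : continuous f ->
  v \in support (f t) ->
  exists2 d, 0 < d & forall s, `|s - t| < d -> v \in support (f s).
Proof.
move=> cf /(support_near (cf t)) /nbhs_ballP[d d0 fd]; exists d => // s st.
by apply: fd; rewrite /ball /= distrC.
Qed.

Lemma support_nearR2 (f : R * R -> T) s t v : continuous f ->
  v \in support (f (s, t)) ->
  exists2 d, 0 < d & forall s' t', `|s' - s| < d -> `|t' - t| < d ->
    v \in support (f (s', t')).
Proof.
move=> cf /(support_near (cf _)) /nbhs_ballP[d d0 fd].
exists d => // s' t' ss tt.
by apply: fd; split; rewrite /ball /= distrC.
Qed.

Section Lift.
Variables (H : groupType) (c : V -> V -> H).
Implicit Types (f : R -> T) (g : R -> V -> H).

(** Repeated vertices are allowed, so this one condition also forces [c v v = 1] and makes [c w v]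
    the inverse of [c v w] on edges of [K]. *)
Definition cocycle := forall u v w, [set u; v; w]%SET \in K ->
  c u w = (c u v * c v w)%g.

(* [g] trivialises along [f] the covering of the realization defined by [c]. *)
Definition lift f (a b : R) g :=
  (forall t v w, a <= t <= b -> v \in support (f t) -> w \in support (f t) ->
     g t w = (g t v * c v w)%g) /\
  (forall t v, a <= t <= b -> v \in support (f t) ->
     exists2 d, 0 < d & forall s, a <= s <= b -> `|s - t| < d -> g s v = g t v).

Hypothesis K_sub : forall s t, s \in K -> t != set0 ->
  t \subset s -> t \in K.

Lemma simplex3 (x : T) u v w : u \in support x -> v \in support x ->
  w \in support x -> [set u; v; w]%SET \in K.
Proof.
move=> xu xv xw; apply: (K_sub (support_in x)).
  by apply/set0Pn; exists u; rewrite !inE eqxx.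
apply/subsetP => z.
by rewrite !in_setU !in_set1 => /orP[/orP[]|] /eqP->.
Qed.

Lemma lift_eq f f' a b g g' : (forall t, a <= t <= b -> f t = f' t) ->
  (forall t, a <= t <= b -> g t =1 g' t) -> lift f a b g -> lift f' a b g'.
Proof.
move=> ff gg [g1 g2]; split=> [t v w tab|t v tab].
  by rewrite -ff // -!gg //; exact: g1.
rewrite -ff // => /g2[|d d0 gd] //; exists d => // s sab st.
by rewrite -!gg //; exact: gd.
Qed.

Lemma lift_sub f a b a' b' g : a <= a' -> b' <= b ->
  lift f a b g -> lift f a' b' g.
Proof.
move=> aa bb [g1 g2].
have sub t : a' <= t <= b' -> a <= t <= b.
  by case/andP=> at_ tb; rewrite (le_trans aa at_) (le_trans tb bb).
split=> [t v w /sub|t v /sub tab /(g2 _ _ tab)[d d0 gd]]; first exact: g1.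
by exists d => // s /sub; exact: gd.
Qed.

Lemma lift_mull f a b g h : lift f a b g -> lift f a b (fun t v => h * g t v)%g.
Proof.
case=> g1 g2; split=> [t v w tab fv fw|t v tab fv].
  by rewrite -mulgA -g1.
by have [d d0 gd] := g2 t v tab fv; exists d => // s sab /(gd _ sab)->.
Qed.

Lemma lift_affine f a b g (m n : R) : 0 < m ->
  lift f (m * a + n) (m * b + n) g ->
  lift (fun t => f (m * t + n)) a b (fun t => g (m * t + n)).
Proof.
move=> m0 [g1 g2].
have sub t : a <= t <= b -> m * a + n <= m * t + n <= m * b + n.
  by case/andP=> at_ tb; rewrite !lerD2r !ler_pM2l // at_ tb.
split=> [t v w /sub|t v /sub tab /(g2 _ _ tab)[d d0 gd]]; first exact: g1.
exists (d / m); first exact: divr_gt0.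
move=> s /sub sab sd; apply: gd => //.
have -> : m * s + n - (m * t + n) = m * (s - t) by ring.
by rewrite normrM gtr0_norm // mulrC -ltr_pdivlMr.
Qed.

Lemma lift_cat f a m b g1 g2 : a <= m -> m <= b ->
  lift f a m g1 -> lift f m b g2 ->
  (forall v, v \in support (f m) -> g1 m v = g2 m v) ->
  lift f a b (fun t => if t <= m then g1 t else g2 t).
Proof.
move=> am mb [A1 A2] [B1 B2] gm; 
  split=> [t v w /andP[at_ tb]|t v /andP[at_ tb] fv].
  by case: ifPn => tm; [apply: A1 | apply: B1]; apply/andP; split=> //;
     rewrite ltW // ltNge.
have [tm|mt|tm] := ltgtP t m.
- have [|d d0 gd] := A2 t v _ fv; first by rewrite at_ ltW.
  exists (Num.min d (m - t)); first by rewrite lt_min d0 subr_gt0.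
  move=> s /andP[as_ sb]; rewrite lt_min => /andP[sd].
  rewrite ltr_norml => /andP[_ sm].
  have sm' : s <= m by lra.
  by rewrite sm'; apply: gd => //; rewrite as_ sm'.
- have [|d d0 gd] := B2 t v _ fv; first by rewrite tb ltW.
  exists (Num.min d (t - m)); first by rewrite lt_min d0 subr_gt0.
  move=> s /andP[as_ sb]; rewrite lt_min => /andP[sd].
  rewrite ltr_norml => /andP[sm _].
  have sm' : m < s by lra.
  by rewrite leNgt sm' /=; apply: gd => //; rewrite sb ltW.
rewrite tm in fv *.
have [|d d0 gd] := A2 m v _ fv; first by rewrite am lexx.
have [|e e0 ge] := B2 m v _ fv; first by rewrite mb lexx.
exists (Num.min d e); first by rewrite lt_min d0.
move=> s /andP[as_ sb]; rewrite lt_min => /andP[sd se].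
case: ifPn => sm; first by rewrite gd ?as_.
by rewrite gm // ge // sb andbT ltW // ltNge.
Qed.

Lemma lift_const f a b g v : a <= b ->
    (forall t, a <= t <= b -> v \in support (f t)) ->
  lift f a b g -> g b v = g a v.
Proof.
move=> ab fv [_ g2]; pose Q x y := g y v = g x v.
apply: (@interval_induction R Q a b ab); rewrite /Q.
  by move=> x m y _ _ _ _ -> ->.
move=> t tab; have [d d0 gd] := g2 t v tab (fv t tab).
exists d => // x y ax xy yb xt yt.
by rewrite !gd // ?ax ?yb ?(le_trans xy yb) ?(le_trans ax xy).
Qed.

Hypothesis c_cocycle : cocycle.

(** As long as the path stays in the star of a vertex [v], the formula [k v * c v w], constant in
    time, is a lift; interval induction glues such pieces. *)
Lemma lift_exists f a b k : continuous f -> a <= b ->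
    (forall v w, v \in support (f a) -> w \in support (f a) ->
       k w = (k v * c v w)%g) ->
  exists2 g, lift f a b g & forall v, v \in support (f a) -> g a v = k v.
Proof.
move=> cf ab.
(* The initial value is quantified inside [Q], since the second piece must start from whatever value
   the first one reaches. *)
pose Q (x y : R) := forall k,
  (forall v w, v \in support (f x) -> w \in support (f x) ->
       k w = (k v * c v w)%g) ->
  exists2 g, lift f x y g & forall v, v \in support (f x) -> g x v = k v.
move: k; apply: (@interval_induction R Q a b ab); rewrite /Q.
  move=> x m y ax xm my yb Q1 Q2 k /Q1[g1 lg1 gk1].
  have [v w xv xw|g2 lg2 gk2] := Q2 (g1 m).
    by case: lg1 => + _; apply; rewrite // xm lexx.
  exists (fun t => if t <= m then g1 t else g2 t); last by rewrite xm.
  by apply: lift_cat => // v xv; rewrite gk2.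
move=> t tab; have [v fv] := support_neq0 (f t).
have [d d0 fd] := support_nearR cf fv.
exists d => // x y ax xy yb xt yt k kf.
have fs s : x <= s <= y -> v \in support (f s).
  case/andP=> xs sy; apply: fd; move: xt yt; rewrite !ltr_norml.
  by move=> /andP[? ?] /andP[? ?]; apply/andP; split; lra.
exists (fun _ w => k v * c v w)%g.
  split=> [s u w sxy fu fw|s u sxy fu]; last by exists 1.
  by rewrite -mulgA -c_cocycle //; apply: simplex3 fu fw; exact: fs.
by move=> w fw; rewrite -kf // fs // lexx.
Qed.

(** Only common vertices are compared, because a lift is arbitrary at vertices outside the current
    support. *)
Definition agree (x x' : T) (k k' : V -> H) :=
  forall v, v \in support x -> v \in support x' -> k v = k' v.

(** Inside the star of [v] a lift is determined by its value at [v], which does not change; the two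
    paths may therefore differ. *)
Lemma agree_star f f' a b g g' v : a <= b ->
    (forall t, a <= t <= b -> v \in support (f t)) ->
    (forall t, a <= t <= b -> v \in support (f' t)) ->
    lift f a b g -> lift f' a b g' ->
  agree (f a) (f' a) (g a) (g' a) -> agree (f b) (f' b) (g b) (g' b).
Proof.
move=> ab fv fv' lg lg' gg w fw fw'.
have aab : a <= a <= b by rewrite lexx.
have bab : a <= b <= b by rewrite lexx andbT.
case: (lg) (lg') => [g1 _] [g1' _].
rewrite (g1 b v) ?fv // (g1' b v) ?fv' //.
by rewrite (lift_const ab fv lg) (lift_const ab fv' lg') gg ?fv ?fv'.
Qed.

Lemma lift_unique f a b g g' v : continuous f -> a <= b ->
    lift f a b g -> lift f a b g' -> v \in support (f a) -> g a v = g' a v ->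
  forall w, w \in support (f b) -> g b w = g' b w.
Proof.
move=> cf ab lg lg' fv gg w fw.
pose Q (x y : R) := agree (f x) (f x) (g x) (g' x) ->
  agree (f y) (f y) (g y) (g' y).
suff QQ : Q a b.
  apply: (QQ) (fw) (fw) => u fu _; case: (lg) (lg') => [g1 _] [g1' _].
  by rewrite (g1 a v) ?lexx // (g1' a v) ?lexx // gg.
apply: (@interval_induction R Q a b ab); rewrite /Q.
  by move=> x m y _ _ _ _ Qm Qy /Qm.
move=> t tab; have [u fu] := support_neq0 (f t).
have [d d0 fd] := support_nearR cf fu.
exists d => // x y ax xy yb xt yt.
have fs s : x <= s <= y -> u \in support (f s).
  case/andP=> xs sy; apply: fd; move: xt yt; rewrite !ltr_norml.
  by move=> /andP[? ?] /andP[? ?]; apply/andP; split; lra.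
by apply: (agree_star (v := u)) => //; exact: (lift_sub ax yb).
Qed.

(** For [s] close to [s0] both paths cross each short time interval inside a common star. Interval
    induction in the time direction keeps a positive radius, since each step only takes a
    minimum. *)
Lemma lift_homotopy (F : R * R -> T) (a b : R) (G : R -> R -> V -> H) s0 :
    continuous F -> a <= b -> (forall s, lift (fun t => F (s, t)) a b (G s)) ->
    (forall s, agree (F (s, a)) (F (s0, a)) (G s a) (G s0 a)) ->
  exists2 d, 0 < d & forall s, `|s - s0| < d ->
    agree (F (s, b)) (F (s0, b)) (G s b) (G s0 b).
Proof.
move=> cF ab lG Ga.
pose Q (x y : R) := (exists2 d, 0 < d & forall s, `|s - s0| < d ->
    agree (F (s, x)) (F (s0, x)) (G s x) (G s0 x)) ->
  exists2 d, 0 < d & forall s, `|s - s0| < d ->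
    agree (F (s, y)) (F (s0, y)) (G s y) (G s0 y).
suff : Q a b by apply; exists 1.
apply: (@interval_induction R Q a b ab); rewrite /Q.
  by move=> x m y _ _ _ _ Qm Qy /Qm.
move=> t tab; have [u fu] := support_neq0 (F (s0, t)).
have [d d0 fd] := support_nearR2 cF fu.
exists d => // x y ax xy yb xt yt [e e0 ae].
exists (Num.min d e); first by rewrite lt_min d0.
move=> s; rewrite lt_min => /andP[sd se].
have fs r : `|r - s0| < d -> forall t, x <= t <= y -> u \in support (F (r, t)).
  move=> rd t' /andP[xs sy]; apply: fd => //; move: xt yt; rewrite !ltr_norml.
  by move=> /andP[? ?] /andP[? ?]; apply/andP; split; lra.
apply: (agree_star (v := u) (f := fun t => F (s, t))
  (f' := fun t => F (s0, t)) xy); last exact: ae.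
- exact: fs.
- by apply: fs; rewrite subrr normr0.
- exact: (lift_sub ax yb).
- exact: (lift_sub ax yb).
Qed.

(** Parallel transport from [v] to [w], normalised at [v]. It is a relation because a lift is not
    unique as a function; the value becomes unique once [v] and [w] lie in the supports of the
    ends. *)
Definition holonomy (f : I -> T) (v w : V) (h : H) :=
  exists g, [/\ lift (fun t => f (clamp t)) 0 1 g, g 0 v = 1%g & g 1 w = h].

Lemma path_clamp_continuous (f : I -> T) : continuous f ->
  continuous (fun t : R => f (clamp t)).
Proof.
move=> cf t; apply: (@continuous_comp _ _ _ (@clamp R) f).
  exact: clamp_continuous.
exact: cf.
Qed.

Lemma holonomy_exists (f : I -> T) v w : continuous f ->
  v \in support (f zero) -> exists h, holonomy f v w h.
Proof.
move=> cf fv; have cc : continuous (fun t : R => f (clamp t)).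
  exact: path_clamp_continuous.
have [u u' fu fu'|g lg gk] := @lift_exists _ 0 1 (c v) cc ler01.
  by rewrite -c_cocycle // (simplex3 (x := f zero)).
exists ((g 0 v)^-1 * g 1%R w)%g, (fun t w => (g 0 v)^-1 * g t w)%g.
by split=> //; [exact: lift_mull | rewrite mulVg].
Qed.

Lemma holonomy_unique (f : I -> T) v w h h' : continuous f ->
  v \in support (f zero) -> w \in support (f one) ->
  holonomy f v w h -> holonomy f v w h' -> h = h'.
Proof.
move=> cf fv fw [g [lg g0 <-]] [g' [lg' g0' <-]].
apply: (lift_unique (v := v) _ ler01 lg lg') => //; last by rewrite g0.
exact: path_clamp_continuous.
Qed.

(** All paths of the homotopy have the same ends, so their lifts can share the initial value [c v];
    the final value at [w] is then locally constant in the homotopy parameter. *)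
Lemma homotopic_holonomy (f f' : I -> T) v w h :
    continuous f -> v \in support (f zero) -> w \in support (f one) ->
    path_homotopic f f' -> holonomy f v w h -> holonomy f' v w h.
Proof.
move=> cf fv fw ff hf; case: ff => F [cF F0 F1 Fz Fo].
(* Clamping extends the homotopy to the plane, since lifts are taken along maps defined on all of
   [R]. *)
pose E (z : R * R) := F (clamp z.1, clamp z.2).
have cE : continuous E.
  apply: (@continuous_clamp2 R T (R * R)%type fst snd F) => // z.
    exact: (@cvg_fst _ _ (nbhs z.1) (nbhs z.2)).
  exact: (@cvg_snd _ _ (nbhs z.1) (nbhs z.2)).
have cEs s : continuous (fun t => E (s, t)).
  move=> t; apply: (@continuous_comp _ _ _ (fun t => (s, t)) E); last exact: cE.
  exact: cvg_pair (cvg_cst _) (@cvg_id _ _).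
have E0 s : E (s, 0) = f zero by rewrite /E Fz.
have E1 s : E (s, 1) = f one by rewrite /E Fo.
have /choice[G HG] s : exists g, lift (fun t => E (s, t)) 0 1 g /\
    forall u, u \in support (f zero) -> g 0 u = c v u.
  have [u u' fu fu'|g lg gk] := @lift_exists _ 0 1 (c v) (cEs s) ler01.
    by rewrite -c_cocycle // (simplex3 (x := E (s, 0))) // E0.
  by exists g; split=> // u; rewrite -(E0 s) => /gk.
have [lG G0] := all_and2 HG.
have Ga s0 s : agree (E (s, 0)) (E (s0, 0)) (G s 0) (G s0 0).
  by move=> u; rewrite !E0 => fu _; rewrite !G0.
pose Q (x y : R) := G y 1 w = G x 1 w.
have : Q 0 1.
  apply: (@interval_induction R Q 0 1 ler01); rewrite /Q.
    by move=> x m y _ _ _ _ -> ->.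
  move=> s _; have [d d0 Gd] := lift_homotopy cE ler01 lG (Ga s).
  exists d => // x y _ _ _ xs ys.
  by rewrite (Gd x) ?(Gd y) // ?E1.
rewrite /Q => GG.
have cvv : c v v = 1%g.
  apply: (mulgI (c v v)).
  by rewrite mulg1 -c_cocycle // (simplex3 (x := f zero)).
have hG0 : holonomy f v w (G 0 1 w).
  exists (G 0); split=> //; last by rewrite G0.
  by apply: lift_eq (lG 0) => // t _; rewrite -F0.
rewrite (holonomy_unique cf fv fw hf hG0) -GG.
exists (G 1); split=> //; last by rewrite G0.
by apply: lift_eq (lG 1) => // t _; rewrite -F1.
Qed.

Lemma holonomy_cat (f f' : I -> T) u v w h h' :
    continuous f -> continuous f' -> f one = f' zero ->
    v \in support (f one) ->
    holonomy f u v h -> holonomy f' v w h' ->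
  holonomy (path_cat f f') u w (h * h')%g.
Proof.
move=> cf cf' ff fv [g [lg g0 <-]] [g' [lg' g0' <-]].
(* The second lift is translated by the value that the first one reaches at [v], where the second
   one is normalised to 1. *)
exists (fun t => if t <= 2^-1 then g (2 * t + 0)
  else (fun w => g 1%R v * g' (2 * t - 1)%R w)%g).
split; last 1 first.
- rewrite ifF; last by apply/negbTE; rewrite -ltNge; lra.
  by rewrite (_ : 2 * 1 - 1 = 1); last ring.
- apply: (lift_cat (m := 2^-1)); rewrite ?invr_ge0 ?ler0n //; first lra.
  + apply: (lift_eq (f := fun t => f (clamp (2 * t + 0)))
      (g := fun t => g (2 * t + 0))) => //.
      move=> t /andP[t0 t2]; rewrite /path_cat clampK; last first.
        by apply/andP; split; lra.
      by rewrite t2 addr0.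
    apply: (lift_affine (f := fun t => f (clamp t)) (m := 2)) => //.
    by rewrite mulr0 addr0 addr0 divff ?pnatr_eq0.
  + apply: (lift_eq (f := fun t => f' (clamp (2 * t - 1)))
      (g := fun t w => (g 1%R v * g' (2 * t - 1)%R w)%g)) => //.
      move=> t /andP[t0 t2]; rewrite /path_cat clampK; last first.
        by apply/andP; split; lra.
      case: ifPn => // t2'; have -> : t = 2^-1 by apply/eqP; rewrite eq_le t2'.
      rewrite divff ?pnatr_eq0 // subrr.
      by rewrite -[clamp 1]/(one : I) -[clamp 0]/(zero : I) ff.
    apply: lift_mull.
    apply: (lift_affine (f := fun t => f' (clamp t)) (m := 2) (n := -1)) => //.
    by rewrite divff ?pnatr_eq0 // subrr (_ : 2 * 1 - 1 = 1); last ring.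
  + move=> x; rewrite addr0 divff ?pnatr_eq0 // subrr => fx.
    have f1 : f (clamp 1) = f one by [].
    have {}fx : x \in support (f one).
      by move: fx; rewrite /path_cat clampK ?divff ?pnatr_eq0 ?lexx //;
        apply/andP; split; lra.
    case: lg => g1 _; rewrite (g1 1 v) ?ler01 ?lexx // ; congr (_ * _)%g.
    have {}g1 := lg'.1; have := g1 0 v x; rewrite g0' mul1g => -> //.
    * by rewrite lexx ler01.
    * by rewrite -[clamp 0]/(zero : I) -ff.
    * by rewrite -[clamp 0]/(zero : I) -ff.
- by rewrite invr_ge0 ler0n mulr0 addr0.
Qed.

End Lift.

End Realization.

(** * The tautological cocycle *)

Section Cone.
Local Open Scope classical_set_scope.
Local Open Scope ring_scope.
Variables (R : realType) (V : finType) (K : {set {set V}}).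

Local Notation T := (realization R K : topologicalType).
Local Notation I := (unit_interval R).

Hypothesis K_sub : forall s t, s \in K -> t != set0 ->
  t \subset s -> t \in K.

Lemma continuous_realization (X : topologicalType) (f : X -> T) :
  (forall v, cts_real (fun x => (\val (f x) : V -> R) v)) -> continuous f.
Proof.
move=> cf; apply: continuous_comp_initial => x; apply/cvg_sup => v.
apply: (continuous_comp_initial (w := fun g : V -> R => g v)).
exact: cf.
Qed.

Lemma realization_inj (x y : T) :
  (forall v, (\val x : V -> R) v = (\val y : V -> R) v) -> x = y.
Proof. by move=> xy; apply: val_inj; apply/funext. Qed.

Variable x0 : T.

(** The point [x0] is a default value for coordinates outside the realization, hence the membership
    conditions in the lemmas below. *)
Definition point (t : V -> R) : T := insubd x0 (t : {ptws V -> R}).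

Lemma point_val (t : V -> R) :
  realization R K t -> \val (point t) = t.
Proof. by move=> Kt; rewrite insubdK //; apply/mem_set. Qed.

Definition vertex (w : V) : T := point (fun v => (v == w)%:R).

Definition cone (x : T) (w : V) (l : R) : T :=
  point (fun v => (1 - l) * (\val x : V -> R) v + l * (v == w)%:R).

Lemma cone_in (x : T) w l : (w |: support x)%SET \in K -> 0 <= l <= 1 ->
  realization R K (fun v => (1 - l) * (\val x : V -> R) v + l * (v == w)%:R).
Proof.
move=> Kx /andP[l0 l1]; have x_ge0 := coord_ge0 x.
have [_ xs _] := set_valP x.
split=> [v||].
- apply: addr_ge0; apply: mulr_ge0 => //; first by rewrite subr_ge0.
- rewrite big_split /= -!mulr_sumr xs (bigD1 w) //= eqxx big1 ?addr0 ?mulr1.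
    by rewrite subrK.
  by move=> v /negbTE->.
apply: (K_sub Kx).
  have [->|ln0] := eqVneq l 0.
    have [v xv] := support_neq0 x; apply/set0Pn; exists v.
    by move: xv; rewrite !inE subr0 mul1r mul0r addr0.
  apply/set0Pn; exists w; rewrite inE eqxx mulr1 gt_eqF //.
  by rewrite ltr_wpDl ?mulr_ge0 ?subr_ge0 // lt0r ln0.
apply/subsetP => v; rewrite !inE; case: (v =P w) => //= _.
by apply: contra => /eqP->; rewrite !mulr0 addr0.
Qed.

Lemma cone_val (x : T) w l v : (w |: support x)%SET \in K -> 0 <= l <= 1 ->
  (\val (cone x w l) : V -> R) v =
  (1 - l) * (\val x : V -> R) v + l * (v == w)%:R.
Proof. by move=> Kx l01; rewrite point_val //; exact: cone_in. Qed.

Lemma vertex_val w v : [set w]%SET \in K ->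
  (\val (vertex w) : V -> R) v = (v == w)%:R.
Proof.
move=> Kw; rewrite point_val //; split=> [u||]; first exact: ler0n.
  by rewrite (bigD1 w) //= eqxx big1 ?addr0 // => u /negbTE->.
rewrite (_ : [set u | _]%SET = [set w]%SET) //.
by apply/setP => u; rewrite !inE pnatr_eq0 eqb0 negbK.
Qed.

Lemma support_vertex w : [set w]%SET \in K -> support (vertex w) = [set w]%SET.
Proof.
by move=> Kw; apply/setP => v; rewrite !inE vertex_val // pnatr_eq0 eqb0 negbK.
Qed.

Lemma simplex_vertex (s : {set V}) w : (w |: s)%SET \in K -> [set w]%SET \in K.
Proof.
move=> Kw; apply: (K_sub Kw); first by apply/set0Pn; exists w; rewrite inE.
by rewrite sub1set !inE eqxx.
Qed.

Lemma cone0 (x : T) w : (w |: support x)%SET \in K -> cone x w 0 = x.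
Proof.
move=> Kx; apply: realization_inj => v; rewrite cone_val ?lexx ?ler01 //.
by rewrite subr0 mul1r mul0r addr0.
Qed.

Lemma cone1 (x : T) w : (w |: support x)%SET \in K -> cone x w 1 = vertex w.
Proof.
move=> Kx; apply: realization_inj => v; rewrite cone_val ?lexx ?ler01 //.
by rewrite subrr mul0r mul1r add0r vertex_val // (simplex_vertex Kx).
Qed.

Lemma support_cone (x : T) w l : (w |: support x)%SET \in K -> 0 <= l <= 1 ->
  support (cone x w l) \subset (w |: support x)%SET.
Proof.
move=> Kx l01; apply/subsetP => v; rewrite !inE cone_val //.
by case: (v =P w) => //= _; apply: contra => /eqP->; rewrite !mulr0 addr0.
Qed.

Lemma cone_continuous (X : topologicalType) (f : X -> T) (l : X -> R) w :
    continuous f -> cts_real l ->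
    (forall x, (w |: support (f x))%SET \in K) -> (forall x, 0 <= l x <= 1) ->
  continuous (fun x => cone (f x) w (l x)).
Proof.
move=> cf cl Kf l01; apply: continuous_realization => v.
have -> : (fun x => (\val (cone (f x) w (l x)) : V -> R) v) =
    fun x => (1 - l x) * (\val (f x) : V -> R) v + l x * (v == w)%:R.
  by apply/funext => x; rewrite cone_val.
have cfv : cts_real (fun x => (\val (f x) : V -> R) v).
  move=> x.
  apply: (@continuous_comp _ _ _ f (fun x : T => (\val x : V -> R) v)).
    exact: cf.
  exact: coord_continuous.
by cts.
Qed.

Definition segment (x : T) (w : V) : I -> T := fun t => cone x w (\val t).

Lemma unit_in01 (t : I) : 0 <= (\val t : R) <= 1.
Proof. exact/andP/unit_interval_bounds. Qed.

Lemma segment_continuous (x : T) w : (w |: support x)%SET \in K ->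
  continuous (segment x w).
Proof.
move=> Kx; apply: (@cone_continuous _ (fun=> x) (fun t : I => \val t)) => //.
- exact: cst_continuous.
- exact: val_continuous.
- exact: unit_in01.
Qed.

Lemma segment0 (x : T) w : (w |: support x)%SET \in K -> segment x w zero = x.
Proof. by move=> Kx; rewrite /segment val_zero cone0. Qed.

Lemma segment1 (x : T) w : (w |: support x)%SET \in K ->
  segment x w one = vertex w.
Proof. by move=> Kx; rewrite /segment val_one cone1. Qed.

Lemma square_homotopic (X : topologicalType) (F : I * I -> X)
    (a1 a2 b1 b2 : I -> R) :
    continuous F -> cts_real a1 -> cts_real a2 -> cts_real b1 -> cts_real b2 ->
    a1 zero = b1 zero -> a2 zero = b2 zero -> a1 one = b1 one ->
    a2 one = b2 one ->
  path_homotopic (fun t => F (clamp (a1 t), clamp (a2 t)))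
    (fun t => F (clamp (b1 t), clamp (b2 t))).
Proof.
move=> cF ca1 ca2 cb1 cb2 e1 e2 e3 e4.
exists (fun z => F (clamp ((1 - \val z.1) * a1 z.2 + \val z.1 * b1 z.2),
                    clamp ((1 - \val z.1) * a2 z.2 + \val z.1 * b2 z.2))).
have c2 (a : I -> R) : cts_real a -> cts_real (fun z : I * I => a z.2).
  by move=> ca z; apply: continuous_comp; [exact: cvg_snd | exact: ca].
have := (c2 _ ca1, c2 _ ca2, c2 _ cb1, c2 _ cb2) => -[[[ca1' ca2'] cb1'] cb2'].
split.
- by apply: continuous_clamp2; cts.
- by move=> t; rewrite val_zero !subr0 !mul1r !mul0r !addr0.
- by move=> t; rewrite val_one !subrr !mul1r !mul0r !add0r.
- by move=> s; rewrite /= -e1 -e2 -!mulrDl !subrK !mul1r.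
- by move=> s; rewrite /= -e3 -e4 -!mulrDl !subrK !mul1r.
Qed.

(** The segments from the points of [f] to [w] fill a square whose last edge is constant at [w]. The
    two routes between opposite corners, run through by [a] and [b] in either order, are homotopic
    by a straight line in the square. *)
Lemma cone_homotopic (f : I -> T) w : continuous f ->
    (forall t, (w |: support (f t))%SET \in K) ->
  path_homotopic (path_cat f (segment (f one) w)) (segment (f zero) w).
Proof.
move=> cf Kf; pose F (z : I * I) := cone (f z.1) w (\val z.2).
have cF : continuous F.
  apply: cone_continuous => //.
  - move=> z; apply: (@continuous_comp _ _ _ fst f); last exact: cf.
    exact: (@cvg_fst _ _ (nbhs z.1) (nbhs z.2)).
  - exact: val2_continuous.
  - by move=> z; exact: unit_in01.
pose a (t : I) : R := \val (clamp (2 * \val t) : I).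
pose b (t : I) : R := \val (clamp (2 * \val t - 1) : I).
have ca : cts_real a.
  by apply: continuous_clamp; [cts | exact: val_continuous].
have cb : cts_real b.
  by apply: continuous_clamp; [cts | exact: val_continuous].
have a0 : a zero = b zero.
  by rewrite /a /b val_zero mulr0 sub0r !clamp_le0 ?lerN10.
have a1 : a one = b one.
  by rewrite /a /b val_one !clamp_ge1 //; lra.
have FE x y : F (x, y) = cone (f x) w (\val y) by [].
have := square_homotopic cF ca cb cb ca a0 (esym a0) a1 (esym a1).
have -> : (fun t : I => F (clamp (a t), clamp (b t))) =
    path_cat f (segment (f one) w).
  apply/funext => t; rewrite /a /b !valK_clamp.
  rewrite /path_cat FE /segment; case: ifPn => t2.
    rewrite [clamp (2 * _ - 1)]clamp_le0 ?val_zero ?cone0 //.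
    by rewrite subr_le0 mulrC -ler_pdivlMr // div1r.
  rewrite [X in f X]clamp_ge1 //.
  by move: t2; rewrite -ltNge => t2; lra.
have -> : (fun t : I => F (clamp (b t), clamp (a t))) =
    path_cat (segment (f zero) w) (cst (vertex w)).
  apply/funext => t; rewrite /a /b !valK_clamp.
  rewrite /path_cat FE /segment; case: ifPn => t2.
    by rewrite [X in f X]clamp_le0 //; lra.
  rewrite [X in cone _ _ X](_ : _ = 1) ?cone1 //.
  by rewrite clamp_ge1 ?val_one //; rewrite -ltNge in t2; lra.
move=> FF; apply: path_homotopic_trans FF _; apply: path_catp1.
  exact: segment_continuous.
exact: segment1.
Qed.

End Cone.

(** * Paths with varying ends and their classes at a fixed base point *)

Section Arcs.
Local Open Scope classical_set_scope.
Local Open Scope ring_scope.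
Local Open Scope quotient_scope.
Variables (R : realType) (T : topologicalType).
Local Notation I := (unit_interval R).
Implicit Types (x y z : T) (f g h : I -> T).

(** A predicate on bare functions, so that concatenating paths with different ends involves no
    dependent types. *)
Definition arc x y f := [/\ continuous f, f zero = x & f one = y].

Lemma arc_cst x : arc x x (cst x).
Proof. by split=> //; exact: cst_continuous. Qed.

Lemma arc_cat x y z f g : arc x y f -> arc y z g -> arc x z (path_cat f g).
Proof.
move=> [cf f0 f1] [cg g0 g1]; split; last by rewrite path_cat_one.
  by apply: path_cat_continuous; rewrite ?f1.
by rewrite path_cat_zero.
Qed.

Lemma arc_rev x y f : arc x y f -> arc y x (path_rev f).
Proof.
move=> [cf f0 f1]; split; first exact: path_rev_continuous.
  by rewrite path_rev_zero.
by rewrite path_rev_one.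
Qed.

Lemma arc_catA x y z t f g h : arc x y f -> arc y z g -> arc z t h ->
  path_homotopic (path_cat f (path_cat g h)) (path_cat (path_cat f g) h).
Proof.
move=> [cf f0 f1] [cg g0 g1] [ch h0 h1].
by apply: path_catA; rewrite // ?f1 ?g1.
Qed.

Lemma arc_homotopic_catl x y z f f' g : arc x y f -> arc y z g ->
  path_homotopic f f' -> path_homotopic (path_cat f g) (path_cat f' g).
Proof.
move=> [cf f0 f1] [cg g0 g1] ff; apply: path_homotopic_cat => //.
  by rewrite f1.
exact: path_homotopic_refl.
Qed.

Lemma arc_homotopic_catr x y z f g g' : arc x y f -> arc y z g ->
  path_homotopic g g' -> path_homotopic (path_cat f g) (path_cat f g').
Proof.
move=> [cf f0 f1] [cg g0 g1] gg; apply: path_homotopic_cat => //.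
  by rewrite f1.
exact: path_homotopic_refl.
Qed.

Lemma arc_catVK x y z f g : arc x y f -> arc y z g ->
  path_homotopic (path_cat (path_rev f) (path_cat f g)) g.
Proof.
move=> af ag; have ar := arc_rev af.
apply: path_homotopic_trans (arc_catA ar af ag) _.
apply: path_homotopic_trans (arc_homotopic_catl _ ag _) _.
- exact: (arc_cat ar af).
- by case: af => cf _ f1; exact: path_catVp f1.
- by case: ag => cg g0 _; exact: path_cat1p.
Qed.

Variable x0 : T.
Local Notation pi1 := (fundamental_group R x0).

Definition loop_class f : pi1 :=
  if pselect (arc x0 x0 f) is left h then
    let: And3 cf f0 f1 := h in
    \pi_pi1 (mk_path cf f0 f1 : {path I from x0 to x0 in T})
  else 1%g.

Lemma loop_class_path (g : {path I from x0 to x0 in T}) :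
  loop_class g = \pi_pi1 g.
Proof.
rewrite /loop_class; case: pselect => [[cg g0 g1]|[]].
  by apply/pi1_eqP; apply: path_homotopic_refl.
by split; [exact: cts_fun | exact: path_zero | exact: path_one].
Qed.

Lemma arc_path f : arc x0 x0 f ->
  exists g : {path I from x0 to x0 in T}, f = g :> (I -> T).
Proof. by case=> cf f0 f1; exists (mk_path cf f0 f1). Qed.

Lemma loop_class_homotopic f g : arc x0 x0 f -> arc x0 x0 g ->
  path_homotopic f g -> loop_class f = loop_class g.
Proof.
move=> /arc_path[f' ->] /arc_path[g' ->]; rewrite !loop_class_path => fg.
exact/pi1_eqP.
Qed.

Lemma loop_class_cat f g : arc x0 x0 f -> arc x0 x0 g ->
  loop_class (path_cat f g) = (loop_class f * loop_class g)%g.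
Proof.
move=> /arc_path[f' ->] /arc_path[g' ->]; rewrite !loop_class_path.
rewrite -[path_cat f' g']/(loop_cat f' g' : I -> T) loop_class_path.
exact/esym/pi1_mulE.
Qed.

Definition reachable y := exists f, arc x0 y f.

Definition tether y : I -> T :=
  if pselect (reachable y) is left h then sval (cid h) else cst y.

Lemma arc_tether y : reachable y -> arc x0 y (tether y).
Proof.
move=> ry; rewrite /tether; case: (pselect (reachable y)) => [h|//].
by case: (cid h).
Qed.

Lemma reachable_arc y z f : arc y z f -> reachable y -> reachable z.
Proof. by move=> af [g ag]; exists (path_cat g f); exact: arc_cat ag af. Qed.

Lemma reachable0 : reachable x0.
Proof. by exists (cst x0); exact: arc_cst. Qed.

(* The class of the loop obtained by joining both ends of a path to [x0]; it
   is trivial by convention outside of the component of [x0]. *)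
Definition arc_class f : pi1 :=
  loop_class (path_cat (path_cat (tether (f zero)) f)
    (path_rev (tether (f one)))).

(** The tether of an unreachable point is the constant path there, so the concatenation does not
    start at [x0] and [loop_class] takes its default value. *)
Lemma arc_class_unreachable f : ~ reachable (f zero) -> arc_class f = 1%g.
Proof.
move=> nr; rewrite /arc_class /loop_class; case: pselect => // h.
exfalso; case: h => _ + _; rewrite !path_cat_zero /tether.
case: pselect => // _ /= fx; apply: nr.
by rewrite [f zero]fx; exact: reachable0.
Qed.

Lemma arc_class_loop y z f : reachable y -> arc y z f ->
  arc x0 x0 (path_cat (path_cat (tether y) f) (path_rev (tether z))).
Proof.
move=> ry af; have rz := reachable_arc af ry.
exact: arc_cat (arc_cat (arc_tether ry) af) (arc_rev (arc_tether rz)).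
Qed.

Lemma arc_class_homotopic y z f g : arc y z f -> arc y z g ->
  path_homotopic f g -> arc_class f = arc_class g.
Proof.
move=> af ag fg; have [cf f0 f1] := af; have [cg g0 g1] := ag.
have [ry|nry] := pselect (reachable y); last first.
  by rewrite !arc_class_unreachable // ?f0 ?g0.
have rz := reachable_arc af ry.
rewrite /arc_class f0 f1 g0 g1.
apply: loop_class_homotopic; [exact: arc_class_loop..|].
apply: (arc_homotopic_catl (arc_cat (arc_tether ry) af)
  (arc_rev (arc_tether rz))).
exact: arc_homotopic_catr (arc_tether ry) af fg.
Qed.

(** The return along the tether of [y] cancels against the next departure along it. Outside the
    component of [x0] all three classes are 1 by default. *)
Lemma arc_class_cat x y z f g : arc x y f -> arc y z g ->
  arc_class (path_cat f g) = (arc_class f * arc_class g)%g.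
Proof.
move=> af ag; have [cf f0 f1] := af; have [cg g0 g1] := ag.
have [rx|nrx] := pselect (reachable x); last first.
  rewrite !arc_class_unreachable ?mulg1 ?path_cat_zero ?f0 ?g0 // => ry.
  exact: nrx (reachable_arc (arc_rev af) ry).
have ry := reachable_arc af rx; have rz := reachable_arc ag ry.
have [tx ty tz] := And3 (arc_tether rx) (arc_tether ry) (arc_tether rz).
rewrite /arc_class path_cat_zero path_cat_one f0 f1 g0 g1.
rewrite -loop_class_cat; [|exact: arc_class_loop..].
apply: loop_class_homotopic.
- exact: arc_class_loop rx (arc_cat af ag).
- by apply: arc_cat; exact: arc_class_loop.
apply: path_homotopic_sym; have txf := arc_cat tx af.
have ty' := arc_rev ty; have tz' := arc_rev tz; have tyg := arc_cat ty ag.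
have agz := arc_cat ag tz'.
apply: path_homotopic_trans (path_homotopic_sym
  (arc_catA txf ty' (arc_cat tyg tz'))) _.
apply: path_homotopic_trans (arc_homotopic_catr txf
  (arc_cat ty' (arc_cat tyg tz'))
  (path_homotopic_trans (arc_homotopic_catr ty' (arc_cat tyg tz')
     (path_homotopic_sym (arc_catA ty ag tz'))) (arc_catVK ty agz))) _.
apply: path_homotopic_trans (arc_catA txf ag tz') _.
apply: (arc_homotopic_catl (arc_cat txf ag) tz').
exact: path_homotopic_sym (arc_catA tx af ag).
Qed.

(** The tether of [x0] is a chosen loop that may be nontrivial, so a conjugation remains. *)
Lemma arc_class_conj (g : {path I from x0 to x0 in T}) :
  arc_class g = ((loop_class (tether x0)) * \pi_pi1 g *
                 (loop_class (tether x0))^-1)%g.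
Proof.
have ag : arc x0 x0 g.
  by split; [exact: cts_fun | exact: path_zero | exact: path_one].
have ta := arc_tether reachable0.
rewrite /arc_class path_zero path_one loop_class_cat; last exact: arc_rev.
  rewrite loop_class_cat // loop_class_path; congr (_ * _ * _)%g.
  have [t ->] := arc_path ta; rewrite -[path_rev t]/(loop_rev t : I -> T).
  by rewrite !loop_class_path -pi1_invE.
exact: arc_cat ta ag.
Qed.

End Arcs.

Section Tautological.
Local Open Scope classical_set_scope.
Local Open Scope ring_scope.
Local Open Scope quotient_scope.
Variables (R : realType) (V : finType) (K : {set {set V}}).

Local Notation T := (realization R K : topologicalType).
Local Notation I := (unit_interval R).

Hypothesis K_sub : forall s t, s \in K -> t != set0 ->
  t \subset s -> t \in K.

Variable x0 : T.
Local Notation pi1 := (fundamental_group R x0).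
Local Notation vertex := (vertex x0).
Local Notation segment := (segment x0).

Definition tautological_cocycle (v w : V) : pi1 :=
  arc_class x0 (segment (vertex v) w).

Lemma arc_segment (x : T) w : (w |: support x)%SET \in K ->
  arc x (vertex w) (segment x w).
Proof.
move=> Kx; split; first exact: (segment_continuous K_sub).
  exact: (segment0 K_sub).
exact: (segment1 K_sub).
Qed.

Lemma simplexW (s t : {set V}) u : (u |: s)%SET \in K -> t \subset s ->
  (u |: t)%SET \in K.
Proof.
move=> Ks ts; apply: (K_sub Ks); last exact: setUS.
by apply/set0Pn; exists u; rewrite !inE eqxx.
Qed.

Lemma arc_class_segment (x : T) v w :
    (v |: (w |: support x))%SET \in K ->
  arc_class x0 (segment x w) =
  (arc_class x0 (segment x v) * tautological_cocycle v w)%g.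
Proof.
move=> Kxvw.
have Kxv : (v |: support x)%SET \in K.
  by apply: simplexW Kxvw _; rewrite subsetUr.
have Kwxv : (w |: (v |: support x))%SET \in K by rewrite setUCA.
have Kxw : (w |: support x)%SET \in K.
  by apply: simplexW Kwxv _; rewrite subsetUr.
have Kv := simplex_vertex K_sub Kxv.
have Kwv : (w |: support (vertex v))%SET \in K.
  rewrite support_vertex //; apply: simplexW Kwxv _.
  by rewrite sub1set !inE eqxx.
have axv := arc_segment Kxv; have axw := arc_segment Kxw.
have avw := arc_segment Kwv.
rewrite -(arc_class_cat x0 axv avw).
apply: (arc_class_homotopic x0) axw (arc_cat axv avw) _.
apply: path_homotopic_sym.
have [cxv x0v x1v] := axv; rewrite -{2}x0v -{1}x1v.
apply: (cone_homotopic K_sub x0 cxv) => t; apply: simplexW Kwxv _.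
apply: (support_cone K_sub) => //; exact: unit_in01.
Qed.

Lemma tautological_cocycleP : cocycle K tautological_cocycle.
Proof.
move=> u v w Kuvw; have Ku : [set u]%SET \in K.
  apply: (K_sub Kuvw); first by apply/set0Pn; exists u; rewrite inE.
  by rewrite -setUA subsetUl.
rewrite {1 2}/tautological_cocycle; apply: arc_class_segment.
rewrite support_vertex // (_ : (_ |: _)%SET = [set u; v; w]%SET) //.
by apply/setP => z; rewrite !inE; do 3!case: (z == _).
Qed.

(** Both sides are reparametrizations of [f] with the same ends, so [b] need not lie between [a] and
    [c]. *)
Lemma path_sub_homotopic (f : I -> T) (a b c : R) : continuous f ->
  path_homotopic
    (path_cat (fun t => f (clamp (a + (b - a) * \val t)))
              (fun t => f (clamp (b + (c - b) * \val t))))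
    (fun t => f (clamp (a + (c - a) * \val t))).
Proof.
move=> cf.
pose m (t : I) : R := a + (b - a) * \val (clamp (2 * \val t) : I) +
  (c - b) * \val (clamp (2 * \val t - 1) : I).
have cm : cts_real m.
  have c1 : cts_real (fun t : I => \val (clamp (2 * \val t) : I) : R).
    by apply: continuous_clamp; [cts | exact: val_continuous].
  have c2 : cts_real (fun t : I => \val (clamp (2 * \val t - 1) : I) : R).
    by apply: continuous_clamp; [cts | exact: val_continuous].
  by rewrite /m; cts.
have -> : path_cat (fun t => f (clamp (a + (b - a) * \val t)))
    (fun t => f (clamp (b + (c - b) * \val t))) = (fun t => f (clamp (m t))).
  apply/funext => t; rewrite /path_cat /m; case: ifPn => t2.
    rewrite [clamp (2 * \val t - 1)]clamp_le0; last by lra.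
    by rewrite val_zero mulr0 addr0.
  have {}t2 : 2^-1 < \val t by rewrite ltNge.
  rewrite [clamp (2 * \val t)]clamp_ge1; last by lra.
  by rewrite val_one mulr1 (addrC a) subrK.
apply: path_homotopic_reparam => //.
- by cts.
- by rewrite /m val_zero clamp_le0 ?clamp_le0 ?val_zero ?mulr0 ?addr0 //; lra.
- rewrite /m val_one clamp_ge1 ?clamp_ge1 ?val_one; [ring|lra|lra].
Qed.

(** At time [t] the lift follows [f] up to [t] and then goes straight to [v]. It is locally constant
    because a short piece of [f] inside the star of [v] can be coned off to [v]. *)
Lemma tautological_lift (f : I -> T) : continuous f ->
  lift tautological_cocycle (fun t => f (clamp t)) 0 1
    (fun t v => arc_class x0 (fun s => f (clamp (t * \val s))) *
                arc_class x0 (segment (f (clamp t)) v))%g.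
Proof.
move=> cf; split=> [t v w _ fv fw|t v _ fv].
  rewrite -mulgA -arc_class_segment //.
  rewrite (_ : (_ |: _)%SET = support (f (clamp t))); first exact: support_in.
  apply/setP => z; rewrite !inE; case: eqP => [->|_].
    by move: fv; rewrite inE => ->.
  by case: eqP => [->|_] //; move: fw; rewrite inE => ->.
have [d d0 fd] := support_nearR (path_clamp_continuous cf) fv.
exists d => // s _ st.
have carc a b : arc (f (clamp a)) (f (clamp b))
    (fun r => f (clamp (a + (b - a) * \val r))).
  split; first by apply: continuous_clamp => //; cts.
    by rewrite val_zero mulr0 addr0.
  by rewrite val_one mulr1 addrC subrK.
have zero_arc a : (fun r : I => f (clamp (a * \val r))) =
    (fun r => f (clamp (0 + (a - 0) * \val r))).
  by apply/funext => r; rewrite add0r subr0.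
have Kstar r : `|r - t| < d -> (v |: support (f (clamp r)))%SET \in K.
  move=> rt; rewrite (setUidPr _) ?sub1set ?fd //.
  exact: support_in.
have tt : `|t - t| < d by rewrite subrr normr0.
rewrite !zero_arc.
have := arc_class_homotopic x0 (arc_cat (carc 0 t) (carc t s)) (carc 0 s)
  (path_sub_homotopic 0 t s cf).
rewrite (arc_class_cat x0 (carc 0 t) (carc t s)) => <-.
rewrite -mulgA; congr (_ * _)%g.
have as_ := arc_segment (Kstar s st); have at_ := arc_segment (Kstar t tt).
rewrite -(arc_class_cat x0 (carc t s) as_).
apply: (arc_class_homotopic x0 (arc_cat (carc t s) as_) at_).
have [cts_ c0 c1] := carc t s.
rewrite -c1 -c0.
apply: (cone_homotopic K_sub x0 cts_) => r; apply: Kstar.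
have /andP[r0 r1] := unit_in01 r.
rewrite addrAC subrr add0r normrM (ger0_norm r0).
by apply: le_lt_trans st; rewrite ler_piMr.
Qed.

(** The element [d] comes from the tether of [x0] and the segment from [x0] to [v]. It is the same
    for all loops, so a loop with trivial holonomy is null-homotopic. *)
Lemma holonomy_tautological v : v \in support x0 ->
  exists d : pi1, forall g : {path I from x0 to x0 in T},
    holonomy tautological_cocycle g v v (d^-1 * \pi_pi1 g * d)%g.
Proof.
move=> xv; pose t0 : pi1 := loop_class x0 (tether x0 x0).
pose q := arc_class x0 (segment x0 v).
exists (t0^-1 * q)%g => g; have lg := tautological_lift (@cts_fun _ _ g).
exists (fun t w => q^-1 * (arc_class x0 (fun s => g (clamp (t * \val s))) *
                arc_class x0 (segment (g (clamp t)) w)))%g.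
have g0 : g (clamp 0) = x0 by exact: path_zero.
have g1 : g (clamp 1) = x0 by exact: path_one.
split; first exact: lift_mull.
  rewrite g0 (_ : (fun s => _) = cst x0); last first.
    by apply/funext => s; rewrite mul0r.
  rewrite -[cst x0]/(loop_cst R x0 : I -> T) arc_class_conj.
  by rewrite -[\pi _]/(1%g : pi1) mulg1 mulgV mul1g mulVg.
rewrite g1 (_ : (fun s => _) = g); last first.
  by apply/funext => s; rewrite mul1r valK_clamp.
by rewrite arc_class_conj invgM invgK !mulgA.
Qed.

Lemma vertex_arc v w : [set v; w]%SET \in K ->
  arc (vertex v) (vertex w) (segment (vertex v) w).
Proof.
move=> Kvw; have Kwv : (w |: [set v])%SET \in K by rewrite setUC.
have Kv := simplex_vertex K_sub Kvw.
by apply: arc_segment; rewrite support_vertex.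
Qed.

Lemma holonomy_segment (H : groupType) (c : V -> V -> H) v w :
  cocycle K c -> [set v; w]%SET \in K ->
  holonomy c (segment (vertex v) w) v w (c v w).
Proof.
move=> cc Kvw; have Kwv : (w |: [set v])%SET \in K by rewrite setUC.
have Kv : [set v]%SET \in K := simplex_vertex K_sub Kvw.
have sv := support_vertex x0 Kv.
exists (fun _ u => c v u); split=> //; last first.
  apply: (mulgI (c v v)); rewrite mulg1 -cc //.
  by rewrite !setUid.
split=> [t u u' _ fu fu'|t u _ _]; last by exists 1.
have sub := support_cone K_sub x0 (x := vertex v) (w := w)
  (l := \val (clamp t : I)).
have {}sub :
    support (segment (vertex v) w (clamp t)) \subset (w |: [set v])%SET.
  by rewrite -sv; apply: sub; [rewrite sv | exact: unit_in01].
apply: cc; apply: (K_sub Kwv).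
  by apply/set0Pn; exists v; rewrite !inE eqxx.
apply/subsetP => z; rewrite in_setU in_set1 in_setU in_set1.
move: (subsetP sub u fu) (subsetP sub u' fu').
rewrite !inE => uE u'E /orP[/orP[]|] /eqP-> //.
by rewrite eqxx orbT.
Qed.

End Tautological.

(** * Cocycles on simply connected complexes *)

Section SimplyConnected.
Local Open Scope classical_set_scope.
Local Open Scope ring_scope.
Local Open Scope quotient_scope.
Variables (R : realType) (V : finType) (K : {set {set V}}).

Local Notation T := (realization R K : topologicalType).
Local Notation I := (unit_interval R).

Hypothesis K_sub : forall s t, s \in K -> t != set0 ->
  t \subset s -> t \in K.

Lemma simply_connected_homotopic (X : topologicalType) (x y : X)
    (f g : I -> X) : simply_connected R X ->
  arc x y f -> arc x y g -> path_homotopic f g.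
Proof.
move=> [_ _ pi1_trivial] af ag; have ar := arc_rev ag.
have [h hE] := arc_path (arc_cat af ar).
have h1 : path_homotopic (path_cat f (path_rev g)) (cst x).
  rewrite hE; apply/(pi1_eqP h (loop_cst R x)).
  by rewrite [LHS]pi1_trivial [RHS]pi1_trivial.
have [cf f0 f1] := af; have [cg g0 g1] := ag.
apply: path_homotopic_trans (path_homotopic_sym (path_catp1 cf f1)) _.
apply: path_homotopic_trans (arc_homotopic_catr af (arc_cst R y)
  (path_homotopic_sym (path_catVp cg g1))) _.
apply: path_homotopic_trans (arc_catA af ar ag) _.
apply: path_homotopic_trans (arc_homotopic_catl (arc_cat af ar) ag h1) _.
exact: path_cat1p.
Qed.

(** The potential at [w] is the holonomy along a chosen path to that vertex. Following the edge from
    [u] to [v] after the path to [u] gives a path homotopic to the one chosen for [v], whence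
    [k v = k u * c u v]. *)
Lemma simply_connected_coboundary (H : groupType) (c : V -> V -> H) :
    simply_connected R T -> cocycle K c ->
  exists k : V -> H, forall u v, [set u; v]%SET \in K ->
    c u v = ((k u)^-1 * k v)%g.
Proof.
move=> scT cc; have [[x0] pcT _] := scT.
have [v0 xv0] := support_neq0 x0.
have /choice[p pP] w : exists p : I -> T, arc x0 (vertex x0 w) p.
  have [p] := pcT x0 (vertex x0 w); exists p.
  by split; [exact: cts_fun | exact: path_zero | exact: path_one].
have /choice[k kP] w : exists k, holonomy c (p w) v0 w k.
  by have [cp p0 _] := pP w; apply: (holonomy_exists K_sub cc); rewrite ?p0.
exists k => u v Kuv.
have Kvu : [set v; u]%SET \in K by rewrite setUC.
have Ku := simplex_vertex K_sub Kuv; have Kv := simplex_vertex K_sub Kvu.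
have auv := vertex_arc K_sub x0 Kuv.
have [cp p0 p1] := pP u; have [cs s0 s1] := auv; have [cq q0 q1] := pP v.
have uin : u \in support (p u one) by rewrite p1 support_vertex ?inE.
have vin : v \in support (p v one) by rewrite q1 support_vertex ?inE.
have hcat := holonomy_cat cp cs (etrans p1 (esym s0)) uin (kP u)
  (holonomy_segment K_sub x0 cc Kuv).
have acat := arc_cat (pP u) auv; have [ccat c0 c1] := acat.
have hv : holonomy c (p v) v0 v (k u * c u v)%g.
  apply: (homotopic_holonomy K_sub cc ccat) hcat; rewrite ?c0 ?c1 -?q1 //.
  exact: (simply_connected_homotopic scT acat (pP v)).
rewrite (holonomy_unique cq _ vin (kP v) hv) ?q0 //.
by rewrite mulKg.
Qed.

End SimplyConnected.

(** * Free groups and the Nielsen-Schreier theorem *)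

Section FreeGroup.
Local Open Scope quotient_scope.
Local Open Scope group_scope.
Variable S : finType.
Local Notation word := (seq (S * bool)).

Definition letter_eval (H : groupType) (u : S -> H) (x : S * bool) : H :=
  if x.2 then (u x.1)^-1 else u x.1.

Definition word_eval (H : groupType) (u : S -> H) (w : word) : H :=
  foldr (fun x h => letter_eval u x * h) 1 w.

Definition word_inv (w : word) : word := rev [seq (x.1, ~~ x.2) | x <- w].

Lemma word_eval_cat (H : groupType) (u : S -> H) w w' :
  word_eval u (w ++ w') = word_eval u w * word_eval u w'.
Proof. by elim: w => [|x w IH] /=; rewrite ?mul1g // IH mulgA. Qed.

Lemma word_eval_rcons (H : groupType) (u : S -> H) w x :
  word_eval u (rcons w x) = word_eval u w * letter_eval u x.
Proof. by rewrite -cats1 word_eval_cat /= mulg1. Qed.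

Lemma word_eval_inv (H : groupType) (u : S -> H) w :
  word_eval u (word_inv w) = (word_eval u w)^-1.
Proof.
elim: w => [|[s b] w IH]; first by rewrite /= invg1.
rewrite /word_inv /= rev_cons word_eval_rcons IH invgM; congr (_ * _).
by case: b => //=; rewrite /letter_eval /= invgK.
Qed.

(* Quotienting by this impredicative relation makes the universal property
   immediate; reduced words are never needed. *)
Definition word_equiv (w w' : word) : bool :=
  `[< forall (H : groupType) (u : S -> H), word_eval u w = word_eval u w' >].

Fact word_equiv_equiv : equiv_class_of word_equiv.
Proof.
split=> [w|w w'|w w' w''].
- exact/asboolP.
- by apply/asboolP/asboolP => ww H u; rewrite ww.
- by move=> /asboolP w1 /asboolP w2; apply/asboolP => H u; rewrite w1 w2.
Qed.

Canonical word_equiv_rel := EquivRelPack word_equiv_equiv.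

Definition free_on := {eq_quot word_equiv_rel}.

HB.instance Definition _ := Choice.on free_on.
HB.instance Definition _ : EqQuotient _ word_equiv_rel free_on :=
  EqQuotient.on free_on.

Definition wcl (w : word) : free_on := \pi_free_on w.

Lemma wclP w w' : wcl w = wcl w' <->
  forall (H : groupType) (u : S -> H), word_eval u w = word_eval u w'.
Proof. by split=> [/eqmodP/asboolP //|ww]; apply/eqmodP/asboolP. Qed.

Lemma wcl_repr (g : free_on) : wcl (repr g) = g.
Proof. exact: reprK. Qed.

Definition free_mul (g h : free_on) : free_on := wcl (repr g ++ repr h).
Definition free_inv (g : free_on) : free_on := wcl (word_inv (repr g)).

Lemma free_mulE w w' : free_mul (wcl w) (wcl w') = wcl (w ++ w').
Proof.
apply/wclP => H u; rewrite !word_eval_cat.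
by have /wclP-> := wcl_repr (wcl w); have /wclP-> := wcl_repr (wcl w').
Qed.

Lemma free_invE w : free_inv (wcl w) = wcl (word_inv w).
Proof.
by apply/wclP => H u; rewrite !word_eval_inv; have /wclP-> := wcl_repr (wcl w).
Qed.

Fact free_mulA : associative free_mul.
Proof.
move=> g h k; rewrite -(wcl_repr g) -(wcl_repr h) -(wcl_repr k).
by rewrite !free_mulE catA.
Qed.

Fact free_mul1 : left_id (wcl [::]) free_mul.
Proof. by move=> g; rewrite -(wcl_repr g) free_mulE. Qed.

Fact free_mulr1 : right_id (wcl [::]) free_mul.
Proof. by move=> g; rewrite -(wcl_repr g) free_mulE cats0. Qed.

Fact free_mulV : left_inverse (wcl [::]) free_inv free_mul.
Proof.
move=> g; rewrite -(wcl_repr g) free_invE free_mulE; apply/wclP => H u.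
by rewrite word_eval_cat word_eval_inv mulVg.
Qed.

Fact free_mulrV : right_inverse (wcl [::]) free_inv free_mul.
Proof.
move=> g; rewrite -(wcl_repr g) free_invE free_mulE; apply/wclP => H u.
by rewrite word_eval_cat word_eval_inv mulgV.
Qed.

HB.instance Definition _ := isGroup.Build free_on
  free_mulA free_mul1 free_mulr1 free_mulV free_mulrV.

Lemma wcl_cat w w' : wcl (w ++ w') = wcl w * wcl w'.
Proof. by rewrite -free_mulE. Qed.

Definition free_gen (s : S) : free_on := wcl [:: (s, false)].

Lemma wcl_rcons w x : wcl (rcons w x) = wcl w * letter_eval free_gen x.
Proof.
rewrite -cats1 wcl_cat; congr (_ * _); case: x => s [] //=.
by rewrite /letter_eval /= -[RHS]/(free_inv (wcl _)) free_invE.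
Qed.

Definition free_ext (H : groupType) (u : S -> H) (g : free_on) : H :=
  word_eval u (repr g).

Lemma free_extE (H : groupType) (u : S -> H) w :
  free_ext u (wcl w) = word_eval u w.
Proof. by rewrite /free_ext; have /wclP-> := wcl_repr (wcl w). Qed.

Lemma free_extM (H : groupType) (u : S -> H) :
  {morph free_ext u : g h / g * h}.
Proof.
move=> g h; rewrite -(wcl_repr g) -(wcl_repr h) -wcl_cat !free_extE.
exact: word_eval_cat.
Qed.

Lemma free_ext_gen (H : groupType) (u : S -> H) s :
  free_ext u (free_gen s) = u s.
Proof. by rewrite free_extE /= mulg1. Qed.

Lemma free_ind (P : free_on -> Prop) :
  (forall w, P (wcl w)) -> forall g, P g.
Proof. by move=> Pw g; rewrite -(wcl_repr g). Qed.

End FreeGroup.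

Section GroupMorphisms.
Local Open Scope group_scope.

Lemma morph_group1 (G H : groupType) (f : G -> H) :
  {morph f : x y / x * y} -> f 1 = 1.
Proof. by move=> fM; apply: (mulgI (f 1)); rewrite -fM !mulg1. Qed.

Lemma morph_groupV (G H : groupType) (f : G -> H) :
  {morph f : x y / x * y} -> {morph f : x / x^-1}.
Proof.
by move=> fM x; apply: (mulgI (f x)); rewrite -fM !mulgV morph_group1.
Qed.

End GroupMorphisms.

Section Twisted.
Local Open Scope group_scope.
Variables (F H : groupType).

(* The semidirect product of [F -> H] by [F] acting by translation. *)
Definition twisted := ((F -> H) * F)%type.
HB.instance Definition _ := Choice.on twisted.

Definition twisted_mul (a b : twisted) : twisted :=
  (fun x => a.1 x * b.1 (x * a.2), a.2 * b.2).
Definition twisted_one : twisted := (fun=> 1, 1).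
Definition twisted_inv (a : twisted) : twisted :=
  (fun x => (a.1 (x * a.2^-1))^-1, a.2^-1).

Fact twisted_mulA : associative twisted_mul.
Proof.
move=> [f a] [g b] [h c]; rewrite /twisted_mul /= mulgA; congr pair.
by apply/funext => x; rewrite !mulgA.
Qed.

Fact twisted_mul1 : left_id twisted_one twisted_mul.
Proof.
move=> [f a]; rewrite /twisted_mul /= mul1g; congr pair.
by apply/funext => x; rewrite mul1g mulg1.
Qed.

Fact twisted_mulr1 : right_id twisted_one twisted_mul.
Proof.
move=> [f a]; rewrite /twisted_mul /= mulg1; congr pair.
by apply/funext => x; rewrite mulg1.
Qed.

Fact twisted_mulV : left_inverse twisted_one twisted_inv twisted_mul.
Proof.
move=> [f a]; rewrite /twisted_mul /twisted_one /= mulVg; congr pair.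
by apply/funext => x; rewrite mulVg.
Qed.

Fact twisted_mulrV : right_inverse twisted_one twisted_inv twisted_mul.
Proof.
move=> [f a]; rewrite /twisted_mul /twisted_one /= mulgV; congr pair.
by apply/funext => x; rewrite mulgK mulgV.
Qed.

HB.instance Definition _ := isGroup.Build twisted
  twisted_mulA twisted_mul1 twisted_mulr1 twisted_mulV twisted_mulrV.

Lemma twisted_mulE (a b : twisted) :
  a * b = (fun x => a.1 x * b.1 (x * a.2), a.2 * b.2) :> twisted.
Proof. by []. Qed.

End Twisted.

(** * Schreier transversals and the wreath product argument *)

Section NielsenSchreier.
Local Open Scope group_scope.
Variables (S : finType) (G : groupType) (th : G -> free_on S).
Hypothesis thM : {morph th : x y / x * y}.
Hypothesis th_inj : injective th.
Local Notation F := (free_on S).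
Local Notation gen := (@free_gen S).
Local Notation word := (seq (S * bool)).

Let th1 : th 1 = 1. Proof. exact: morph_group1. Qed.
Let thV : {morph th : x / x^-1}. Proof. exact: morph_groupV. Qed.

(* Bijective base-[#|S * bool|] numeration: comparing words by their codes is
   compatible with appending a letter, so minimal words are prefix-closed. *)
Definition code (w : word) : nat :=
  foldl (fun n x => n * #|{: S * bool}| + (enum_rank x).+1)%N 0%N w.

Lemma code_rcons w x :
  code (rcons w x) = (code w * #|{: S * bool}| + (enum_rank x).+1)%N.
Proof. by rewrite /code -cats1 foldl_cat. Qed.

Lemma code_ltn w w' x :
  (code w < code w')%N -> (code (rcons w x) < code (rcons w' x))%N.
Proof.
move=> ww; rewrite !code_rcons ltn_add2r ltn_mul2r ww andbT.
by apply/card_gt0P; exists x.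
Qed.

Lemma code_inj : injective code.
Proof.
elim/last_ind=> [|w x IH] w'.
  by case/lastP: w' => // w' x; rewrite code_rcons addnS.
case/lastP: w' => [|w' x']; rewrite !code_rcons !addnS // => -[].
set b := #|_|; have xb := ltn_ord (enum_rank x).
have xb' := ltn_ord (enum_rank x').
move=> e; have /IH-> : code w = code w'.
  have := congr1 (divn^~ b) e; rewrite /= !divnMDl ?(leq_ltn_trans _ xb) //.
  by rewrite !divn_small // !addn0.
have /ord_inj/enum_rank_inj-> // : enum_rank x = enum_rank x' :> nat.
by have := congr1 (modn^~ b) e; rewrite /= !modnMDl !modn_small.
Qed.

Definition same_coset (g h : F) := exists k, h = th k * g.

Lemma same_coset_refl g : same_coset g g.
Proof. by exists 1; rewrite th1 mul1g. Qed.

Lemma same_coset_sym g h : same_coset g h -> same_coset h g.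
Proof. by case=> k ->; exists k^-1; rewrite thV mulKg. Qed.

Lemma same_coset_trans g h i :
  same_coset g h -> same_coset h i -> same_coset g i.
Proof. by case=> k -> [l ->]; exists (l * k); rewrite thM mulgA. Qed.

Lemma same_cosetM g h x : same_coset g h -> same_coset (g * x) (h * x).
Proof. by case=> k ->; exists k; rewrite mulgA. Qed.

Definition minimal_word (g : F) (w : word) :=
  same_coset g (wcl w) /\
  forall w', same_coset g (wcl w') -> (code w <= code w')%N.

Lemma minimal_word_exists g : exists w, minimal_word g w.
Proof.
pose P n := `[< exists2 w, code w = n & same_coset g (wcl w) >].
have exP : exists n, P n.
  exists (code (repr g)); apply/asboolP; exists (repr g) => //.
  by rewrite wcl_repr; exact: same_coset_refl.
case: (ex_minnP exP) => _ /asboolP[w <- gw] wmin; exists w; split=> // w' gw'.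
by apply: wmin; apply/asboolP; exists w'.
Qed.

Lemma minimal_word_unique g g' w w' : same_coset g g' ->
  minimal_word g w -> minimal_word g' w' -> w = w'.
Proof.
move=> gg [gw wmin] [gw' wmin']; apply: code_inj; apply/eqP.
rewrite eqn_leq wmin ?wmin' //; last exact: same_coset_trans gg gw'.
exact: same_coset_trans (same_coset_sym gg) gw.
Qed.

Definition rep_word (g : F) : word := sval (cid (minimal_word_exists g)).
Definition rep (g : F) : F := wcl (rep_word g).

Lemma rep_wordP g : minimal_word g (rep_word g).
Proof. by rewrite /rep_word; case: cid. Qed.

Lemma rep_word_eq g w : minimal_word g w -> rep_word g = w.
Proof.
move=> gw; apply: minimal_word_unique (rep_wordP g) gw.
exact: same_coset_refl.
Qed.

Lemma rep_coset g : same_coset g (rep g).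
Proof. by case: (rep_wordP g). Qed.

Lemma same_rep g g' : same_coset g g' -> rep g = rep g'.
Proof.
move=> gg; congr wcl.
exact: minimal_word_unique gg (rep_wordP g) (rep_wordP g').
Qed.

Lemma rep_word1 : rep_word 1 = [::].
Proof. by apply: rep_word_eq; split=> //; exact: same_coset_refl. Qed.

Lemma rep1 : rep 1 = 1. Proof. by rewrite /rep rep_word1. Qed.

(** The Schreier property: a smaller word in the coset of the prefix, completed by the last letter,
    would be a smaller word in the coset of [g]. *)
Lemma rep_word_prefix g w x : rep_word g = rcons w x ->
  rep_word (wcl w) = w.
Proof.
move=> gwx; apply: rep_word_eq; split=> [|w' ww]; first exact: same_coset_refl.
rewrite leqNgt; apply/negP => /(@code_ltn _ _ x); apply/negP; rewrite -leqNgt.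
have [gw wmin] := rep_wordP g; rewrite gwx in gw wmin; apply: wmin.
apply: same_coset_trans gw _; rewrite !wcl_rcons.
exact: same_cosetM.
Qed.

Lemma schreier_exists g s :
  exists k, th k = rep g * gen s * (rep (g * gen s))^-1.
Proof.
have [k ->] := rep_coset g; have [l ->] := rep_coset (g * gen s).
by exists (k * l^-1); rewrite thM thV !invgM !mulgA mulgK mulgK.
Qed.

Definition schreier g s : G := sval (cid (schreier_exists g s)).

Lemma th_schreier g s :
  th (schreier g s) = rep g * gen s * (rep (g * gen s))^-1.
Proof. by rewrite /schreier; case: cid. Qed.

Lemma schreier_coset g g' s : same_coset g g' -> schreier g s = schreier g' s.
Proof.
move=> gg; apply: th_inj; rewrite !th_schreier (same_rep gg).
by rewrite (same_rep (same_cosetM (gen s) gg)).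
Qed.

Section Extension.
Variables (H : groupType) (u : G -> H).

(** The given [u] may have any value at 1, but a trivial Schreier element must be sent to 1; the
    basis excludes it. *)
Let u' k := if k == 1 then 1 else u k.

(** A morphism from the ambient free group into [twisted] is determined by generators; its first
    component, read at 1 on the image of [th], is the wanted extension of [u]. It is a crossed
    morphism, which [transfer_coset] turns into a morphism on that image. *)
Definition schreier_twist (s : S) : twisted F H :=
  (fun g => u' (schreier g s), gen s).

Definition transfer (g x : F) : H := (free_ext schreier_twist g).1 x.

Lemma transfer_snd g : (free_ext schreier_twist g).2 = g.
Proof.
elim/free_ind: g => w; rewrite free_extE.
elim/last_ind: w => // w [s b] IH.
rewrite word_eval_rcons wcl_rcons twisted_mulE /= IH; congr (_ * _).
by rewrite /letter_eval /=; case: b.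
Qed.

Lemma transferM g h x : transfer (g * h) x = transfer g x * transfer h (x * g).
Proof. by rewrite /transfer free_extM twisted_mulE /= transfer_snd. Qed.

Lemma transfer1 x : transfer 1 x = 1.
Proof.
by apply: (mulgI (transfer 1 x)); rewrite -{2}(mulg1 x) -transferM !mulg1.
Qed.

Lemma transferV g x : transfer g^-1 x = (transfer g (x * g^-1))^-1.
Proof.
apply: (mulgI (transfer g (x * g^-1))).
by rewrite -{2}(mulgVK g x) -transferM !mulgV transfer1.
Qed.

Lemma transfer_gen s x : transfer (gen s) x = u' (schreier x s).
Proof. by rewrite /transfer free_ext_gen. Qed.

Lemma transfer_coset g x x' : same_coset x x' -> transfer g x = transfer g x'.
Proof.
elim/free_ind: g x x' => w; elim/last_ind: w => [|w [s b] IH] x x' xx.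
  by rewrite -[wcl _]/(1 : F) !transfer1.
have xwx := same_cosetM (wcl w) xx.
rewrite wcl_rcons !transferM (IH _ _ xx); congr (_ * _).
rewrite /letter_eval /=; case: b.
  rewrite !transferV !transfer_gen; congr (u' _)^-1.
  exact: schreier_coset (same_cosetM _ xwx).
by rewrite !transfer_gen (schreier_coset s xwx).
Qed.

(** Prefixes of a representative are representatives, so every letter contributes a trivial Schreier
    element. Hence in the product defining a Schreier element only the middle generator counts. *)
Lemma transfer_rep g : transfer (rep g) 1 = 1.
Proof.
rewrite /rep; move E: (rep_word g) => w.
elim/last_ind: w g E => [|w [s b] IH] g gw.
  by rewrite -[wcl _]/(1 : F) transfer1.
have ww := rep_word_prefix gw.
have rw : rep (wcl w) = wcl w by rewrite /rep ww.
have gwx : rep (wcl (rcons w (s, b))) = wcl (rcons w (s, b)).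
  by rewrite /rep -gw; congr wcl; apply: minimal_word_unique (rep_wordP _)
    (rep_wordP g); exact: same_coset_sym (rep_coset g).
rewrite wcl_rcons transferM (IH _ ww) !mul1g; rewrite wcl_rcons in gwx.
move: gwx; rewrite /letter_eval /=; case: b {gw} => gwx.
  rewrite transferV transfer_gen /u' ifT ?invg1 //; apply/eqP/th_inj.
  by rewrite th_schreier gwx mulgVK rw mulgV th1.
rewrite transfer_gen /u' ifT //; apply/eqP/th_inj.
by rewrite th_schreier gwx rw mulgV th1.
Qed.

Definition schreier_ext (k : G) : H := transfer (th k) 1.

Lemma schreier_extM : {morph schreier_ext : k l / k * l}.
Proof.
move=> k l; rewrite /schreier_ext thM transferM; congr (_ * _).
by apply: transfer_coset; exists k^-1; rewrite thV mul1g mulVg.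
Qed.

Lemma schreier_ext_schreier g s : schreier g s != 1 ->
  schreier_ext (schreier g s) = u (schreier g s).
Proof.
move=> n1; have <- : u' (schreier g s) = u (schreier g s) by rewrite /u' ifN.
rewrite /schreier_ext th_schreier !transferM transfer_rep !mul1g transfer_gen.
rewrite -(schreier_coset s (rep_coset g)) transferV -th_schreier.
rewrite (@transfer_coset _ _ 1) ?transfer_rep ?invg1 ?mulg1 //.
by exists (schreier g s)^-1; rewrite thV mulVg.
Qed.

End Extension.

Definition schreier_basis : set G :=
  [set k | k != 1 /\ exists g s, k = schreier g s].

(** Reidemeister rewriting: the element of [G] that carries the representative of a word to the word
    itself changes, with each further letter, by a Schreier element or its inverse. *)
Lemma schreier_unique (H : groupType) (f f' : G -> H) :
    {morph f : x y / x * y} -> {morph f' : x y / x * y} ->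
    (forall k, schreier_basis k -> f k = f' k) ->
  f =1 f'.
Proof.
move=> fM fM' ff.
have fsch g s k : th k = rep g * gen s * (rep (g * gen s))^-1 -> f k = f' k.
  rewrite -th_schreier => /th_inj->.
  have [->|n1] := eqVneq (schreier g s) 1; first by rewrite !morph_group1.
  by apply: ff; split=> //; exists g, s.
suff fw w k : th k * rep (wcl w) = wcl w -> f k = f' k.
  move=> k; apply: (fw (repr (th k))); rewrite wcl_repr.
  rewrite -(@same_rep 1) ?rep1 ?mulg1 //; exists k; exact/esym/mulg1.
elim/last_ind: w k => [|w [s b] IH] k.
  rewrite -[wcl _]/(1 : F) rep1 mulg1 -th1 => /th_inj->.
  by rewrite !morph_group1.
have [l lE] := same_coset_sym (rep_coset (wcl w)).
have fl := IH l (esym lE); rewrite wcl_rcons /letter_eval /=; case: b => kE.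
  set g := wcl w * (gen s)^-1 in kE *.
  have gs : g * gen s = wcl w by rewrite mulgVK.
  have fkl : f (k^-1 * l) = f' (k^-1 * l).
    apply: (fsch g s); rewrite thM thV gs.
    apply: (mulIg (rep (wcl w))); rewrite mulgVK -mulgA -lE -gs -{1}kE.
    by rewrite -(mulgA (th k)) mulKg.
  apply: invg_inj; rewrite -(morph_groupV fM) -(morph_groupV fM').
  by apply: (mulIg (f l)); rewrite -fM fkl fM' fl.
have fkl : f (l^-1 * k) = f' (l^-1 * k).
  apply: (fsch (wcl w) s); rewrite thM thV.
  apply: (mulIg (rep (wcl w * gen s))); rewrite mulgVK -mulgA kE.
  by rewrite {1}lE -!mulgA mulKg.
apply: (mulgI (f l^-1)).
by rewrite -fM fkl fM' (morph_groupV fM) (morph_groupV fM') fl.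
Qed.

Theorem subgroup_of_free : free_group G.
Proof.
exists schreier_basis => H u; exists (schreier_ext u); split.
  split; first exact: schreier_extM.
  by move=> k [+ [g [s kE]]]; rewrite kE => /schreier_ext_schreier->.
move=> f [fM fu]; apply/funext; apply: schreier_unique => //.
  exact: schreier_extM.
move=> k kB; rewrite fu //; case: kB => + [g [s kE]].
by rewrite kE => /schreier_ext_schreier->.
Qed.

End NielsenSchreier.

(** * Universal cocycles and posets *)

Section FreenessCriterion.
Local Open Scope group_scope.
Variables (R : realType) (V : finType) (K : {set {set V}}).

Local Notation T := (realization R K : topologicalType).
Local Notation I := (unit_interval R).

Hypothesis K_sub : forall s t, s \in K -> t != set0 ->
  t \subset s -> t \in K.

Lemma simplex2 (x : T) v w : v \in support x -> w \in support x ->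
  [set v; w]%SET \in K.
Proof.
move=> xv xw; have := simplex3 K_sub xv xv xw.
by rewrite setUid.
Qed.

Lemma holonomy_gauge (H H' : groupType) (c : V -> V -> H) (c' : V -> V -> H')
    (al : H -> H') (k : V -> H') (f : I -> T) v w h :
    {morph al : x y / x * y} ->
    (forall v w, [set v; w]%SET \in K ->
       c' v w = (k v)^-1 * al (c v w) * k w) ->
  holonomy c f v w h -> holonomy c' f v w ((k v)^-1 * al h * k w).
Proof.
move=> alM cc [g [[g1 g2] g0 <-]].
exists (fun t u => (k v)^-1 * al (g t u) * k u); split=> //; last first.
  by rewrite g0 morph_group1 // mulg1 mulVg.
split=> [t u u' tab fu fu'|t u tab /(g2 _ _ tab)[d d0 gd]].
  by rewrite cc ?(simplex2 fu fu') // (g1 t u u') // alM !mulgA mulgK.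
by exists d => // s sab /(gd _ sab)->.
Qed.

Variables (S : finType) (cu : V -> V -> free_on S).
Hypothesis cu_cocycle : cocycle K cu.
Hypothesis cu_universal : forall (H : groupType) (c : V -> V -> H),
  cocycle K c -> exists (u : S -> H) (k : V -> H),
    forall v w, [set v; w]%SET \in K ->
      c v w = (k v)^-1 * free_ext u (cu v w) * k w.

(** Holonomy of [cu] is a morphism to a free group. It is injective because the tautological cocycle
    is obtained from [cu] by a morphism and a gauge change: a loop with trivial holonomy for [cu]
    has trivial tautological holonomy, hence trivial class. *)
Theorem free_fundamental_group (x : T) : free_group (fundamental_group R x).
Proof.
have [v xv] := support_neq0 x; set pi1 := fundamental_group R x.
have vz (f : {path I from x to x in T}) : v \in support (f zero).
  by rewrite path_zero.
have vo (f : {path I from x to x in T}) : v \in support (f one).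
  by rewrite path_one.
have /choice[th thP] (a : pi1) : exists h, holonomy cu (repr a) v v h.
  apply: (holonomy_exists K_sub cu_cocycle); first exact: cts_fun.
  exact: vz.
have thM : {morph th : a b / a * b}.
  move=> a b; apply: (holonomy_unique (@cts_fun _ _ _) (vz _) (vo _) (thP _)).
  have hab : path_homotopic (loop_cat (repr a) (repr b)) (repr (a * b)).
    by apply: path_homotopic_sym; exact: repr_pi.
  apply: (homotopic_holonomy K_sub cu_cocycle _ _ _ hab) => //.
  - exact: cts_fun.
  - apply: (holonomy_cat _ _ _ _ (thP a) (thP b)) => //; try exact: cts_fun.
    by rewrite path_one path_zero.
apply: (subgroup_of_free thM) => a b ab.
have th1 : th (a^-1 * b) = 1.
  by rewrite thM (morph_groupV thM) ab mulVg.
suff e1 : a^-1 * b = 1 by apply: (mulgI a^-1); rewrite e1 mulVg.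
move: (a^-1 * b) th1 => {ab} g g1.
have [u [k ck]] := cu_universal (tautological_cocycleP K_sub x).
have [d hd] := holonomy_tautological K_sub xv.
have := holonomy_gauge (free_extM u) ck (thP g).
move=> /(holonomy_unique (@cts_fun _ _ _) (vz _) (vo _) (hd _)).
rewrite g1 (morph_group1 (free_extM u)) mulg1 mulVg reprK => e.
by apply: (mulgI d^-1); apply: (mulIg d); rewrite e mulg1 mulVg.
Qed.

End FreenessCriterion.

(** * Cocycles on finite posets *)

Section PosetCocycles.
Local Open Scope group_scope.
Variables (V : finType) (le : rel V).
Hypotheses (le_refl : reflexive le) (le_anti : antisymmetric le)
  (le_trans : transitive le).
Implicit Types (P Q : {set V}).

Definition poset_cocycle (H : groupType) P (c : V -> V -> H) :=
  forall a b d, a \in P -> b \in P -> d \in P -> le a b -> le b d ->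
    c a d = c a b * c b d.

Definition coboundary (H : groupType) P (c : V -> V -> H) :=
  exists k : V -> H, forall a b, a \in P -> b \in P -> le a b ->
    c a b = (k a)^-1 * k b.

(** Geometrically, all components are simply connected. Nothing is said about the number of
    components, and the empty poset qualifies. *)
Definition cocycle_trivial P := forall (H : groupType) (c : V -> V -> H),
  poset_cocycle P c -> coboundary P c.

Lemma poset_cocycle1 (H : groupType) P (c : V -> V -> H) a :
  poset_cocycle P c -> a \in P -> c a a = 1.
Proof. by move=> cc aP; apply: (mulgI (c a a)); rewrite -cc // mulg1. Qed.

Lemma poset_cocycleS (H : groupType) P Q (c : V -> V -> H) :
  Q \subset P -> poset_cocycle P c -> poset_cocycle Q c.
Proof.
by move=> /subsetP QP cc a b d /QP aP /QP bP /QP dP; exact: cc.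
Qed.

Lemma order_complex_sub P s t : s \in order_complex le P ->
  t != set0 -> t \subset s -> t \in order_complex le P.
Proof.
rewrite !inE => /and3P[_ sP /forall_inP sle] t0 ts.
rewrite t0 (subset_trans ts sP); apply/forall_inP => v vt.
apply/forall_inP => w wt; have /forall_inP := sle v (subsetP ts v vt).
by apply; exact: (subsetP ts).
Qed.

Lemma order_complexP P s : reflect
  [/\ s != set0, {subset s <= P} &
      forall a b, a \in s -> b \in s -> le a b || le b a]
  (s \in order_complex le P).
Proof.
rewrite inE; apply: (iffP and3P) => -[s0 sP sle].
  split=> // [|a b sa sb]; first exact/subsetP.
  by have /forall_inP/(_ b sb) := forall_inP sle a sa.
split=> //; first exact/subsetP.
by apply/forall_inP => a sa; apply/forall_inP => b sb; exact: sle.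
Qed.

Lemma order_complex2 P a b : a \in P -> b \in P -> le a b ->
  [set a; b]%SET \in order_complex le P.
Proof.
move=> aP bP ab; apply/order_complexP; split.
- by apply/set0Pn; exists a; rewrite inE in_set1 eqxx.
- by move=> x; rewrite !inE => /orP[] /eqP->.
- by move=> x y; rewrite !inE => /orP[] /eqP-> /orP[] /eqP->;
  rewrite ?le_refl ?ab ?orbT.
Qed.

Lemma order_complex3 P a b d : a \in P -> b \in P -> d \in P ->
  le a b -> le b d -> [set a; b; d]%SET \in order_complex le P.
Proof.
move=> aP bP dP ab bd; have ad := le_trans ab bd; apply/order_complexP; split.
- by apply/set0Pn; exists a; rewrite !inE eqxx.
- by move=> x; rewrite !inE => /orP[/orP[]|] /eqP->.
- by move=> x y; rewrite !inE => /orP[/orP[]|] /eqP-> /orP[/orP[]|] /eqP->;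
  rewrite ?le_refl ?ab ?bd ?ad ?orbT.
Qed.

Definition symmetrize (H : groupType) (c : V -> V -> H) v w : H :=
  if le v w then c v w else (c w v)^-1.

Lemma symmetrize_cocycle (H : groupType) P (c : V -> V -> H) :
  poset_cocycle P c -> cocycle (order_complex le P) (symmetrize c).
Proof.
move=> cc u v w /order_complexP[_ sP scmp].
have [uP vP wP] : [/\ u \in P, v \in P & w \in P].
  by split; apply: sP; rewrite !inE eqxx ?orbT.
have cmp x y : x \in [set u; v; w]%SET -> y \in [set u; v; w]%SET ->
    le x y = false -> le y x.
  by move=> sx sy xy; have := scmp x y sx sy; rewrite xy.
have [us vs ws] : [/\ u \in [set u; v; w]%SET, v \in [set u; v; w]%SET
    & w \in [set u; v; w]%SET] by split; rewrite !inE eqxx ?orbT.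
have c1 := fun x => @poset_cocycle1 _ P c x cc.
have anti x y : le x y -> le y x -> x = y.
  by move=> xy yx; apply: le_anti; rewrite xy.
rewrite /symmetrize.
case uv: (le u v); case vw: (le v w); case uw: (le u w).
- exact: cc.
- by rewrite (le_trans uv vw) in uw.
- have wv := cmp _ _ vs ws vw; rewrite (cc u w v) // ?mulgK //.
- have wv := cmp _ _ vs ws vw; have wu := cmp _ _ us ws uw.
  by rewrite (cc w u v) // invgM mulVKg.
- have vu := cmp _ _ us vs uv; by rewrite (cc v u w) // mulKg.
- have vu := cmp _ _ us vs uv; have wu := cmp _ _ us ws uw.
  by rewrite (cc v w u) // invgM mulgVK.
(* The cyclic pattern [u <= w <= v <= u] collapses to a single vertex, against the failure of
   [le u v]. *)
- have vu := cmp _ _ us vs uv; have wv := cmp _ _ vs ws vw.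
  have wu := le_trans wv vu; have uw' := anti _ _ uw wu; subst w.
  by have vu' := anti _ _ vu wv; subst v; rewrite le_refl in uv.
- have vu := cmp _ _ us vs uv; have wv := cmp _ _ vs ws vw.
  by rewrite (cc w v u) // invgM.
Qed.

Lemma simply_connected_trivial (R : realType) P :
  simply_connected R (realization R (order_complex le P)) -> cocycle_trivial P.
Proof.
move=> sc H c /symmetrize_cocycle cc.
have [k kP] := simply_connected_coboundary (@order_complex_sub P) sc cc.
exists k => a b aP bP ab; rewrite -kP ?order_complex2 //.
by rewrite /symmetrize ab.
Qed.

(** In [Ap p G] these are the subgroups of rank at least 2; the order-theoretic form keeps the
    freeness criterion valid for all finite posets. *)
Definition nonminimal P :=
  [set b in P | [exists a in P, (a != b) && le a b]]%SET.

Lemma nonminimalP P a b : a \in P -> b \in P -> a != b -> le a b ->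
  b \in nonminimal P.
Proof.
move=> aP bP ab leab; rewrite inE bP.
by apply/exists_inP; exists a; rewrite ?ab.
Qed.

Section Universal.
Variable P : {set V}.

Definition upper_link a : rel V := fun b d =>
  [&& b \in P, d \in P, a != b, a != d, le a b, le a d & le b d || le d b].

Lemma upper_link_sym a : connect_sym (upper_link a).
Proof.
apply: sym_connect_sym => b d; rewrite /upper_link [le b d || _]orbC.
by case: (b \in P); case: (d \in P); case: (a != b); case: (a != d);
  case: (le a b); case: (le a d).
Qed.

(* Generators are indexed by a minimal element [a] together with a connected
   component, named by its root, of the elements above [a]. *)
Definition universal_cocycle a b : free_on (V * V)%type :=
  if (a \notin nonminimal P) && (a != b)
  then free_gen (a, fingraph.root (upper_link a) b) else 1.

Lemma universal_cocycleP : poset_cocycle P universal_cocycle.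
Proof.
move=> a b d aP bP dP ab bd; rewrite /universal_cocycle.
have [<-|nab] := eqVneq a b; first by rewrite andbF mul1g.
rewrite (nonminimalP aP bP nab ab) mulg1 andbT.
have nad : a != d.
  by apply: contraNneq nab => ad; apply/eqP/le_anti; rewrite ab ad.
rewrite nad andbT; case: ifP => // _; congr (free_gen (_, _)).
have [-> //|nbd] := eqVneq b d.
apply/eqP; rewrite eq_sym (root_connect (upper_link_sym a)).
by apply: connect1; rewrite /upper_link bP dP nab nad ab (le_trans ab bd) bd.
Qed.

Lemma universal_cocycle_coboundary (H : groupType) (c : V -> V -> H) :
    poset_cocycle P c -> coboundary (nonminimal P) c ->
  exists (u : V * V -> H) (k : V -> H), forall a b, a \in P -> b \in P ->
    le a b -> c a b = (k a)^-1 * free_ext u (universal_cocycle a b) * k b.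
Proof.
move=> cc [k0 ck0].
pose k a := if a \in nonminimal P then k0 a else 1.
(* This is [c] after the gauge change, which is 1 at minimal elements. It is constant along
   comparable elements above [x.1], so it descends to components. *)
pose u (x : V * V) := c x.1 x.2 * (k x.2)^-1.
have ck a b : a \in nonminimal P -> b \in nonminimal P -> le a b ->
    c a b = (k a)^-1 * k b.
  by move=> an bn ab; rewrite /k an bn; exact: ck0.
have u_edge a b d : a \in P -> b \in P -> d \in P -> a != b -> a != d ->
    le a b -> le b d -> u (a, b) = u (a, d).
  move=> aP bP dP nab nad ab bd; rewrite /u /= (cc a b d) //.
  rewrite (ck b d) ?(nonminimalP aP) ?(le_trans ab bd) //.
  by rewrite !mulgA mulgK.
exists u, k => a b aP bP ab; rewrite /universal_cocycle.
have [<-|nab] := eqVneq a b.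
  rewrite andbF (morph_group1 (free_extM u)) mulg1 mulVg.
  exact: poset_cocycle1 cc aP.
have bn := nonminimalP aP bP nab ab; rewrite andbT.
case: ifPn => [an|/negbNE an].
  rewrite {1}/k (negbTE an) invg1 mul1g free_ext_gen.
  suff <- : u (a, b) = u (a, fingraph.root (upper_link a) b).
    by rewrite /u mulgVK.
  have /connectP[p + ->] := connect_root (upper_link a) b.
  elim: p b {bP ab nab bn} => //= d p IH b /andP[bd /IH<-]; 
  case/and5P: bd => bP dP nab nad /and3P[ab ad] /orP[] bd.
    exact: u_edge.
  by rewrite (u_edge a d b).
by rewrite (morph_group1 (free_extM u)) mulg1; exact: ck.
Qed.

Theorem free_fundamental_group_poset (R : realType)
    (x : realization R (order_complex le P) : topologicalType) :
    (forall (H : groupType) (c : V -> V -> H), poset_cocycle P c ->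
      coboundary (nonminimal P) c) ->
  free_group (fundamental_group R x).
Proof.
move=> cob.
apply: (free_fundamental_group (@order_complex_sub P)
  (symmetrize_cocycle universal_cocycleP)) => H c cc.
have pc : poset_cocycle P c.
  by move=> a b d aP bP dP ab bd; apply: cc; exact: order_complex3.
have [u [k ck]] := universal_cocycle_coboundary pc (cob H c pc).
exists u, k => v w vw; have /order_complexP[_ sP scmp] := vw.
have [vP wP] : v \in P /\ w \in P.
  by split; apply: sP; rewrite !inE eqxx ?orbT.
rewrite /symmetrize; case: ifPn => le_vw; first exact: ck.
have wv : le w v.
  have := scmp v w; rewrite (negbTE le_vw) /=.
  by apply; rewrite !inE eqxx ?orbT.
have cvw : c v w = (c w v)^-1.
  have Kv : [set v]%SET \in order_complex le P.
    apply: (order_complex_sub vw); last by rewrite sub1set !inE eqxx.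
    by apply/set0Pn; exists v; rewrite inE.
  have cvv : c v v = 1.
    by apply: (mulgI (c v v)); rewrite mulg1 -cc // !setUid.
  apply: (mulIg (c w v)); rewrite mulVg -cc ?cvv //.
  by rewrite setUAC setUid.
by rewrite cvw ck // (morph_groupV (free_extM u)) !invgM invgK mulgA.
Qed.

End Universal.
End PosetCocycles.

Section Connected.
Local Open Scope group_scope.
Variables (V : finType) (le : rel V).

(** Connectedness tested on locally constant functions, which is how it is applied to differences of
    potentials; the empty poset qualifies. *)
Definition poset_connected (P : {set V}) := forall (T : Type) (k : V -> T),
  (forall a b, a \in P -> b \in P -> le a b -> k a = k b) ->
  forall a b, a \in P -> b \in P -> k a = k b.

End Connected.

Section Links.
Local Open Scope group_scope.
Variables (V : finType) (le : rel V).
Hypothesis le_refl : reflexive le.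
Variable P : {set V}.

(** The value of a potential at a minimal [a] is forced by each [b] above it; connectedness of the
    elements above [a] makes these values coincide. *)
Lemma coboundary_links (H : groupType) (c : V -> V -> H) :
    poset_cocycle le P c -> coboundary le (nonminimal le P) c ->
    (forall a, a \in P -> a \notin nonminimal le P ->
       poset_connected le [set b in P | (a != b) && le a b]%SET) ->
  coboundary le P c.
Proof.
move=> cc [k0 k0P] conn; pose N := nonminimal le P.
have link a : exists h : H, a \in P -> a \notin N -> forall b, b \in P ->
    a != b -> le a b -> h = k0 b * (c a b)^-1.
  case: (pickP [pred b in P | (a != b) && le a b]) =>
      [b0 /and3P[b0P nab0 ab0]|no].
    exists (k0 b0 * (c a b0)^-1) => aP aN b bP nab ab.
    apply: (conn a aP aN H (fun b => k0 b * (c a b)^-1)); rewrite ?inE.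
    - move=> x y; rewrite !inE => /and3P[xP nax ax] /and3P[yP nay ay] xy.
      rewrite (cc a x y) // (k0P x y) ?(nonminimalP aP) // !invgM !mulgA.
      by rewrite invgK mulgV mul1g.
    - by rewrite b0P nab0 ab0.
    - by rewrite bP nab ab.
  by exists 1 => _ _ b bP nab ab; have := no b; rewrite /= bP nab ab.
have [k1 k1P] := choice link.
exists (fun a => if a \in N then k0 a else k1 a) => a b aP bP ab.
have [<-|nab] := eqVneq a b; first by rewrite mulVg (poset_cocycle1 le_refl cc).
have bN : b \in N := nonminimalP aP bP nab ab.
rewrite bN; case: ifPn => aN; first exact: k0P.
by rewrite (k1P a aP aN b) // invgM invgK mulgVK.
Qed.

End Links.

(** * A fibre theorem for cocycles *)

Section Fibres.
Local Open Scope group_scope.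
Variables (V W : finType) (leV : rel V) (leW : rel W).
Hypotheses (leV_refl : reflexive leV) (leW_refl : reflexive leW)
  (leW_trans : transitive leW).
Variables (P : {set V}) (Q : {set W}) (f : V -> W).

Definition poset_fibre b := [set a in P | leW (f a) b]%SET.

Hypothesis fP : forall a, a \in P -> f a \in Q.
Hypothesis f_mono : forall a b, a \in P -> b \in P -> leV a b ->
  leW (f a) (f b).
Hypothesis f_strict : forall a b, a \in P -> b \in P -> leV a b -> f a = f b ->
  a = b.
Hypothesis fibre_neq0 : forall b, b \in Q -> exists a, a \in poset_fibre b.
Hypothesis fibre_connected : forall b, b \in nonminimal leW Q ->
  poset_connected leV (poset_fibre b).
Hypothesis fibre_trivial : forall b d, b \in nonminimal leW Q -> d \in Q ->
  b != d -> leW b d -> cocycle_trivial leV (poset_fibre d).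
Hypothesis base_trivial : cocycle_trivial leW Q.

Lemma poset_fibreS b d : leW b d -> poset_fibre b \subset poset_fibre d.
Proof.
move=> bd; apply/subsetP => a; rewrite !inE => /andP[-> ab].
exact: leW_trans bd.
Qed.

Lemma nonminimal_image a : a \in nonminimal leV P -> f a \in nonminimal leW Q.
Proof.
rewrite !inE => /andP[aP /exists_inP[b bP /andP[nba ba]]].
rewrite fP //; apply/exists_inP; exists (f b); rewrite ?fP ?f_mono // andbT.
by apply: contraNneq nba => fba; apply/eqP/f_strict.
Qed.

(* A potential [h b] of the cocycle on each fibre is unique up to a constant as
   soon as the fibre is connected; comparing [h b] and [h d] defines a cocycle
   on the base, whose potential corrects the [h b] to a global one. *)
Lemma fibre_coboundary (H : groupType) (c : V -> V -> H) :
  poset_cocycle leV P c -> coboundary leV (nonminimal leV P) c.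
Proof.
move=> cc.
case: (pickP (mem P)) => [a0 _|P0]; last first.
  exists (fun=> 1) => a b; rewrite inE => /andP[aP _].
  by have := P0 a; rewrite /= aP.
have /choice[s sP] b : exists a, b \in Q -> a \in poset_fibre b.
  have [bQ|nbQ] := boolP (b \in Q); last by exists a0.
  by have [a] := fibre_neq0 bQ; exists a.
have /choice[h hP] b : exists h : V -> H, coboundary leV (poset_fibre b) c ->
    forall x y, x \in poset_fibre b -> y \in poset_fibre b -> leV x y ->
    c x y = (h x)^-1 * h y.
  have [[h hP]|ncob] := pselect (coboundary leV (poset_fibre b) c).
    by exists h.
  by exists (fun=> 1).
have fibP b : {subset poset_fibre b <= P}.
  by move=> x; rewrite inE => /andP[].
have good b d : b \in nonminimal leW Q -> d \in Q -> b != d -> leW b d ->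
    coboundary leV (poset_fibre d) c.
  move=> bN dQ nbd bd; apply: fibre_trivial bN dQ nbd bd _ _ _.
  by apply: poset_cocycleS cc; apply/subsetP; exact: fibP.
have hconst b d x y : b \in nonminimal leW Q -> d \in Q -> b != d -> leW b d ->
    x \in poset_fibre b -> y \in poset_fibre b ->
  h b x * (h d x)^-1 = h b y * (h d y)^-1.
  move=> bN dQ nbd bd; have gd := good b d bN dQ nbd bd.
  have bd_sub := subsetP (poset_fibreS bd).
  have gb : coboundary leV (poset_fibre b) c.
    by have [k kP] := gd; exists k => z t /bd_sub zb /bd_sub tb; exact: kP.
  apply: (fibre_connected bN (k := fun x => h b x * (h d x)^-1)).
  move=> z t zb tb zt.
  have := hP b gb z t zb tb zt.
  rewrite (hP d gd z t (bd_sub _ zb) (bd_sub _ tb) zt) => e.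
  apply: (mulgI (h b z)^-1); rewrite mulKg mulgA -e.
  by rewrite -mulgA mulgV mulg1.
pose e b d := h b (s b) * (h d (s b))^-1.
(* In a strict chain the middle [b'] is nonminimal, so [hconst] moves its base point to [s b]. For
   minimal [b] the function [h b] may be the default one; only its value at [s b] enters. *)
have ecoc : poset_cocycle leW Q e.
  move=> b b' b'' bQ b'Q b''Q bb' b'b''; rewrite /e.
  have [<-|nb] := eqVneq b b'; first by rewrite mulgV mul1g.
  have [<-|nb'] := eqVneq b' b''; first by rewrite mulgV mulg1.
  have b'N := nonminimalP bQ b'Q nb bb'.
  have sb : s b \in poset_fibre b'.
    exact: subsetP (poset_fibreS bb') _ (sP b bQ).
  rewrite (hconst b' b'' _ (s b)) ?sP //.
  by rewrite !mulgA mulgVK.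
have [m mP] := base_trivial ecoc.
exists (fun a => m (f a) * h (f a) a) => a b aN bN ab.
have [aP bP] : a \in P /\ b \in P.
  by move: aN bN; rewrite !inE => /andP[-> _] /andP[-> _].
have [<-|nab] := eqVneq a b.
  by rewrite mulVg (poset_cocycle1 leV_refl cc).
have fab := f_mono aP bP ab; have faN := nonminimal_image aN.
have nfab : f a != f b.
  by apply: contraNneq nab => /(f_strict aP bP ab)->.
have gb := good _ _ faN (fP bP) nfab fab.
have afa : a \in poset_fibre (f a) by rewrite inE aP leW_refl.
have afb : a \in poset_fibre (f b) by rewrite inE aP fab.
have bfb : b \in poset_fibre (f b) by rewrite inE bP leW_refl.
rewrite (hP _ gb a b) //.
have := mP (f a) (f b) (fP aP) (fP bP) fab; rewrite /e.
rewrite (hconst (f a) (f b) _ a) ?sP ?fP // => E.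
suff -> : m (f a) * h (f a) a = m (f b) * h (f b) a.
  by rewrite invgM !mulgA mulgVK.
apply: (mulgI (m (f a))^-1); rewrite mulKg mulgA -E.
by rewrite mulgVK.
Qed.

End Fibres.

(** * Posets of elementary abelian p-subgroups *)

From mathcomp Require Import fingroup quotient center.

Local Open Scope group_scope.

(** * Generation by centralizers under coprime action *)

Section CoprimeAction.

(** On a minimal [A]-invariant subgroup [N0] of the center, the noncyclic abelian group [A] cannot
    act both faithfully and irreducibly, so some nontrivial [a] centralizes [N0] and [N0] lies in
    [M]. Centralizers in [N / N0] lift by coprimeness, and induction applies. *)
Lemma qgroup_cent1_gen (q : nat) (gT : finGroupType) (A N M : {group gT}) :
    q.-group N -> abelian A -> ~~ cyclic A -> A \subset 'N(N) ->
    coprime #|N| #|A| -> (forall a, a \in A^# -> 'C_N[a] \subset M) ->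
  N \subset M.
Proof.
have [n] := ubnP #|N|; elim: n => // n IH in gT A N M *; rewrite ltnS => leNn.
move=> qN cAA ncA nNA coNA CM.
have [->|ntN] := eqVneq (N : {set gT}) 1; first exact: sub1G.
have ntZ : 'Z(N) != 1 by apply: contraNneq ntN => /(trivg_center_pgroup qN)/eqP.
have nZA : A \subset 'N('Z(N)) := char_norm_trans (center_char N) nNA.
have [N0 minN0 sN0Z] := minnormal_exists ntZ nZA.
have sN0N : N0 \subset N := subset_trans sN0Z (center_sub N).
have nN0N : N \subset 'N(N0).
  by rewrite cents_norm // centsC (subset_trans sN0Z) // subIset // subxx orbT.
have solN : solvable N := nilpotent_sol (pgroup_nil qN).
have [nN0A ntN0 abN0] := minnormal_solvable minN0 sN0N solN.
have sN0M : N0 \subset M.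
  have [r _ abelN0] := is_abelemP abN0.
  have /trivgPn[a /setIP[Aa cNa] nta] : 'C_A(N0) != 1.
    apply: contraNneq ncA => C1.
    apply: (mx_faithful_irr_abelian_cyclic
      (abelem_mx_faithful abelN0 ntN0 nN0A C1) _ cAA).
    exact/abelem_mx_irrP.
  apply: subset_trans (CM a _); last by rewrite !inE nta.
  by rewrite subsetI sN0N sub_cent1.
have tiAN0 : N0 :&: A = 1.
  by apply: coprime_TIg; exact: coprimeSg sN0N coNA.
have : N / N0 \subset M / N0.
  apply: (IH _ (A / N0)%G).
  - by apply: leq_trans leNn; exact: ltn_quotient.
  - exact: quotient_pgroup.
  - exact: quotient_abelian.
  - by rewrite -(isog_cyclic (quotient_isog nN0A tiAN0)).
  - exact: quotient_norms.
  - exact: coprime_morph.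
  move=> b /setD1P[ntb /morphimP[a nN0a Aa bE]]; rewrite {b}bE in ntb *.
  have coNa : coprime #|N| #|<[a]>|.
    by apply: coprimegS coNA; rewrite cycle_subG.
  have nN0ca : <[a]> \subset 'N(N0) by rewrite cycle_subG.
  have := coprime_quotient_cent sN0N nN0ca coNa solN.
  rewrite cent_cycle quotient_cycle // cent_cycle => <-.
  apply/quotientS/CM; rewrite !inE Aa andbT.
  by apply: contraNneq ntb => ->; rewrite morph1.
by rewrite quotientSK // mulSGid.
Qed.

(** For every prime [q] there is an [A]-invariant Sylow [q]-subgroup of [N], which lies in [M] by
    the prime power case; so the order of [N] divides that of [N :&: M]. *)
Lemma coprime_cent1_gen (gT : finGroupType) (A N M : {group gT}) :
    abelian A -> ~~ cyclic A -> A \subset 'N(N) ->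
    coprime #|N| #|A| -> (forall a, a \in A^# -> 'C_N[a] \subset M) ->
  N \subset M.
Proof.
move=> cAA ncA nNA coNA CM.
suff : #|N| %| #|N :&: M|.
  move/(dvdn_leq (cardG_gt0 _)) => leNM.
  by apply/setIidPl/eqP; rewrite eqEcard subsetIl.
apply/dvdn_partP => // q _.
have [Q sylQ nQA] := sol_coprime_Sylow_exists q (abelian_sol cAA) nNA coNA.
have sQN := pHall_sub sylQ.
rewrite -(card_Hall sylQ); apply: cardSg; rewrite subsetI sQN /=.
apply: (qgroup_cent1_gen (pHall_pgroup sylQ) cAA ncA nQA).
  exact: coprimeSg coNA.
by move=> a Aa; apply: subset_trans (CM a Aa); exact: setSI.
Qed.

Lemma pgroup_sub_conj (p : nat) (gT : finGroupType) (A N E : {group gT}) :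
    p.-group A -> p^'.-group N -> A \subset 'N(N) ->
    p.-group E -> E \subset N <*> A ->
  exists2 n, n \in N & E \subset A :^ n.
Proof.
move=> pA p'N nNA pE sENA.
have coNA : coprime #|N| #|A| by rewrite coprime_sym (pnat_coprime pA).
have sylA : p.-Sylow(N <*> A) A.
  rewrite pHallE joing_subr /= norm_joinEr // TI_cardMg ?coprime_TIg //.
  by rewrite partnM // part_p'nat // mul1n part_pnat_id.
have [x] := Sylow_Jsub sylA sENA pE.
rewrite -groupV /= norm_joinEr // -(normC nNA) => ANx sEA.
case/mulsgP: ANx => a n Aa Nn xE; exists n => //.
by rewrite -(conjGid Aa) -conjsgM -xE -sub_conjg.
Qed.

End CoprimeAction.

Definition subgroup_rel (gT : finGroupType) : rel {group gT} :=
  fun A B => A \subset B.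
Arguments subgroup_rel {gT}.

(** * Connectivity of the poset of [NA] and of its upper links *)

Section Ap.
Variable gT : finGroupType.
Implicit Types (p : nat) (A B D E F G N : {group gT}).

Lemma subgroup_rel_refl : reflexive (@subgroup_rel gT).
Proof. by move=> A; exact: subxx. Qed.

Lemma subgroup_rel_anti : antisymmetric (@subgroup_rel gT).
Proof. by move=> A B AB; apply/val_inj/eqP; rewrite eqEsubset. Qed.

Lemma subgroup_rel_trans : transitive (@subgroup_rel gT).
Proof. by move=> A B D; exact: subset_trans. Qed.

Lemma ApP p G A :
  reflect [/\ A \subset G, p.-abelem A & A :!=: 1] (A \in Ap p G).
Proof.
rewrite in_setD1 -val_eqE /=.
by apply: (iffP andP) => [[ntA /pElemP[]]|[sAG abelA ntA]]; split=> //;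
  apply/pElemP.
Qed.

Lemma Ap_gt1 p G A : A \in Ap p G -> 0 < logn p #|A|.
Proof.
case/ApP=> _ abelA ntA; have pA := abelem_pgroup abelA.
rewrite lt0n; apply: contraNneq ntA => l0.
by apply/eqP/card1_trivg; rewrite (card_pgroup pA) l0.
Qed.

Lemma abelem_logn_sub p A B : p.-abelem B -> A \subset B ->
  logn p #|B| <= logn p #|A| -> A :=: B.
Proof.
move=> abelB sAB le_BA; have pB := abelem_pgroup abelB.
have [B1|/(pgroup_pdiv pB)[p_pr _ _]] := eqVneq (B : {set gT}) 1.
  by rewrite B1; apply/trivgP; rewrite -B1.
apply/eqP; rewrite eqEcard sAB (card_pgroup pB) (card_pgroup (pgroupS sAB pB)).
by rewrite leq_exp2l // prime_gt1.
Qed.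

(** Every member lies in a conjugate of [A] by an element of [N], so it suffices to connect these
    conjugates. A complement [A1] of [D] in [A] has rank at least 2, so [N] is generated by the
    centralizers of the nontrivial elements of [A1]. *)
Lemma Ap_link_connected p A N D :
    p.-abelem A -> p^'.-group N -> A \subset 'N(N) ->
    D \subset A -> D \subset 'C(N) -> (logn p #|D|).+1 < logn p #|A| ->
  poset_connected subgroup_rel
    [set E in Ap p (N <*> A) | (D != E) && (D \subset E)].
Proof.
move=> abelA p'N nNA sDA cND ltDA.
set Q := [set E in Ap p (N <*> A) | (D != E) && (D \subset E)] => T k kQ.
have [A1 defA] := abelem_split_dprod abelA sDA.
have [_ sA1] : D \subset A /\ A1 \subset A.
  by case/dprodP: defA => _ <- _ _; rewrite mulG_subl mulG_subr.
have pA := abelem_pgroup abelA; have cAA := abelem_abelian abelA.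
have tiDA1 : D :&: A1 = 1 by case/dprodP: defA.
have ncA1 : ~~ cyclic A1.
  rewrite (abelem_cyclic (abelemS sA1 abelA)) -ltnNge.
  move: ltDA; rewrite -(dprod_card defA) lognM //.
  by rewrite -[(logn p #|D|).+1]addn1 ltn_add2l.
have QP E : E \in Q -> [/\ E \in Ap p (N <*> A), D != E & D \subset E].
  by rewrite inE => /and3P[].
have inQ (F : {group gT}) n :
    n \in N -> D \subset F -> F != D -> F \subset A :^ n -> F \in Q.
  move=> Nn sDF nFD sFA; rewrite inE eq_sym nFD sDF !andbT.
  apply/ApP; split.
  - apply: subset_trans sFA _; rewrite -(conjGid (mem_gen _ : n \in N <*> A)).
      by rewrite conjSg joing_subr.
    by rewrite inE Nn.
  - by apply: abelemS sFA _; rewrite abelemJ.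
  - apply: contraNneq nFD => F1; apply/eqP/val_inj/eqP.
    by rewrite eqEsubset sDF /= F1 sub1G.
have DJ n : n \in N -> D :^ n = D.
  move=> Nn; apply: normP; apply: (subsetP (cent_sub _)).
  by apply: (subsetP _ n Nn); rewrite centsC.
have AJ n : n \in N -> (A :^ n)%G \in Q.
  move=> Nn; apply: (inQ _ n) => //=; first by rewrite -(DJ n Nn) conjSg.
  apply: contraTneq ltDA => AD; rewrite -leqNgt -(cardJg A n).
  by rewrite [A :^ n](congr1 val AD).
have toA E : E \in Q -> exists2 n, n \in N & k E = k (A :^ n)%G.
  move=> EQ; have [/ApP[sE abelE _] _ _] := QP E EQ.
  have [n Nn sEA] := pgroup_sub_conj pA p'N nNA (abelem_pgroup abelE) sE.
  by exists n => //; apply: kQ => //; exact: AJ.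
suff kA n : n \in N -> k (A :^ n)%G = k A.
  by move=> E F /toA[n Nn ->] /toA[m Nm ->]; rewrite !kA.
(* Quantifying over all further conjugations by [m] makes this set closed under products. *)
pose M := [set n in N | `[< forall m, m \in N ->
  k (A :^ (n * m))%G = k (A :^ m)%G >]].
have gM : group_set M.
  apply/group_setP; split.
    by rewrite inE group1; apply/asboolP => m _; rewrite mul1g.
  move=> x y; rewrite !inE => /andP[Nx /asboolP kx] /andP[Ny /asboolP ky].
  rewrite groupM //; apply/asboolP => m Nm.
  by rewrite -mulgA kx ?ky // groupM.
move=> Nn; suff /subsetP sNM : N \subset Group gM.
   have := sNM n Nn; rewrite inE => /andP[_ /asboolP/(_ 1)].
  rewrite group1 mulg1 => -> //; congr k; apply/val_inj; exact: conjsg1.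
apply: (coprime_cent1_gen (abelianS sA1 cAA) ncA1) => {n Nn}.
- exact: subset_trans nNA.
- by rewrite coprime_sym (pnat_coprime (pgroupS sA1 pA)).
move=> a /setD1P[nta A1a]; apply/subsetP => n /setIP[Nn /cent1P can].
rewrite inE Nn; apply/asboolP => m Nm.
(* [F] is centralized by [n] and strictly contains [D], so its conjugate by [m] is a member lying
   below both conjugates of [A]. *)
pose F := (D <*> <[a]>)%G.
have sFA : F \subset A.
  by rewrite join_subG sDA cycle_subG (subsetP sA1).
have FJ : F :^ n = F.
  apply: normP; apply: (subsetP (cent_sub _)).
  rewrite centY inE cent_cycle; apply/andP; split.
    by apply: (subsetP _ n Nn); rewrite centsC.
  exact/cent1P.
have FQ x : x \in N -> F :^ m \subset A :^ x -> (F :^ m)%G \in Q.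
  move=> Nx sFx; apply: (inQ _ x) => //=.
    by rewrite -{1}(DJ m Nm) conjSg joing_subl.
  apply/eqP => /(congr1 val)/= FD.
  have FD' : F :=: D by apply: (@conjsg_inj _ m); rewrite [LHS]FD DJ.
  have : a \in D :&: A1.
    by rewrite inE A1a andbT -FD' mem_gen // inE cycle_id orbT.
  by rewrite tiDA1 inE (negPf nta).
have sFm : F :^ m \subset A :^ m by rewrite conjSg.
have sFnm : F :^ m \subset A :^ (n * m) by rewrite conjsgM conjSg -FJ conjSg.
have Qm := FQ m Nm sFm.
rewrite -(kQ (F :^ m)%G (A :^ m)%G) ?AJ //.
by rewrite -(kQ (F :^ m)%G (A :^ (n * m))%G) ?AJ ?groupM.
Qed.

Lemma Ap_connected p A N : p.-abelem A -> p^'.-group N -> A \subset 'N(N) ->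
  1 < logn p #|A| -> poset_connected subgroup_rel (Ap p (N <*> A)).
Proof.
move=> abelA p'N nNA ltA.
have := @Ap_link_connected p A N 1%G abelA p'N nNA (sub1G _) (sub1G _).
rewrite cards1 logn1 => /(_ ltA).
rewrite (_ : [set E in _ | _] = Ap p (N <*> A)) //.
apply/setP => E; rewrite inE sub1G andbT andb_idr //.
by case/ApP=> _ _; rewrite eq_sym -val_eqE.
Qed.

(** Abelian subgroups containing [D] centralize it. After conjugating [A] so that it contains [D],
    the modular law places them in ['C_N(D) <*> A :^ n], where [D] centralizes the [p']-part. *)
Lemma Ap_upper_link_connected p A N D :
    p.-abelem A -> p^'.-group N -> A \subset 'N(N) ->
    D \in Ap p (N <*> A) -> (logn p #|D|).+1 < logn p #|A| ->
  poset_connected subgroup_rel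
    [set E in Ap p (N <*> A) | (D != E) && (D \subset E)].
Proof.
move=> abelA p'N nNA /ApP[sD abelD ntD] ltDA.
have [n Nn sDA] := pgroup_sub_conj (abelem_pgroup abelA) p'N nNA
  (abelem_pgroup abelD) sD.
have nNAn : A :^ n \subset 'N(N).
  by rewrite -(normsP (normG N) n Nn) normJ conjSg.
have := @Ap_link_connected p (A :^ n)%G 'C_N(D)%G D.
rewrite /= abelemJ cardJg centsC subsetIr.
move=> /(_ abelA (pgroupS (subsetIl _ _) p'N)).
have cDA : A :^ n \subset 'C(D).
  rewrite centsC (subset_trans sDA) // sub_abelian_cent ?abelianJ //.
  exact: abelem_abelian abelA.
rewrite normsI // ?norms_cent ?(subset_trans cDA (cent_sub _)) //.
move=> /(_ isT sDA isT ltDA).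
have -> // : [set E in Ap p ('C_N(D) <*> A :^ n) | (D != E) && (D \subset E)] =
  [set E in Ap p (N <*> A) | (D != E) && (D \subset E)].
apply/setP => E; rewrite !inE; apply: andb_id2r => /andP[nDE sDE].
have defG : N <*> A = N * A :^ n.
  rewrite -norm_joinEr //; apply/eqP.
  rewrite eqEsubset !join_subG !joing_subl /=.
  have Nn1 : n \in N <*> A by rewrite mem_gen // inE Nn.
  have Nn2 : n \in N <*> A :^ n by rewrite mem_gen // inE Nn.
  apply/andP; split; last by rewrite -(conjGid Nn1) conjSg joing_subr.
  by rewrite -(conjSg _ _ n) (conjGid Nn2) joing_subr.
have sub : E \subset N <*> A -> p.-abelem E -> E \subset 'C_N(D) <*> A :^ n.
  move=> sE abelE; rewrite norm_joinEr; last first.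
    by rewrite normsI // norms_cent // (subset_trans cDA (cent_sub _)).
  rewrite /= setIC group_modr // -defG subsetI sE andbT centsC.
  by rewrite (subset_trans sDE) // sub_abelian_cent ?(abelem_abelian abelE).
have sup : 'C_N(D) <*> A :^ n \subset N <*> A.
  by rewrite defG -norm_joinEr // genS // setSU // subsetIl.
apply/andP/andP => -[ntE]; rewrite ?inE => /andP[sE abelE]; split=> //.
  by rewrite (subset_trans sE).
by rewrite sub.
Qed.

End Ap.

Section Nonminimal.
Variables (gT : finGroupType) (p : nat).
Implicit Types (A B E G : {group gT}).

Lemma Ap_nonminimal_gt1 G A : A \in nonminimal subgroup_rel (Ap p G) ->
  1 < logn p #|A|.
Proof.
rewrite inE => /andP[AP /exists_inP[B BP /andP[nBA sBA]]].
apply: leq_ltn_trans (Ap_gt1 BP) _; rewrite ltnNge.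
apply: contra nBA => leAB; case/ApP: AP => _ abelA _.
by apply/eqP/val_inj; exact: abelem_logn_sub abelA sBA leAB.
Qed.

Lemma Ap_minimal_le1 G A : A \in Ap p G ->
  A \notin nonminimal subgroup_rel (Ap p G) -> logn p #|A| <= 1.
Proof.
move=> AP; rewrite leqNgt; apply: contra => ltA.
have /ApP[sAG abelA ntA] := AP; have pA := abelem_pgroup abelA.
have [p_pr p_dvd _] := pgroup_pdiv pA ntA.
have [x Ax ox] := Cauchy p_pr p_dvd.
have sxA : <[x]> \subset A by rewrite cycle_subG.
apply: (nonminimalP (a := <[x]>%G)) => //.
  apply/ApP; split; first exact: subset_trans sAG.
    exact: abelemS abelA.
  by rewrite -cardG_gt1 -[#|_|]/(#[x]) ox prime_gt1.
apply: contraTneq ltA => <-.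
by rewrite -leqNgt -[#|_|]/(#[x]) ox logn_prime // eqxx.
Qed.

End Nonminimal.

(** * Groups with a nontrivial normal p-subgroup *)

Section Pcore.
Variables (gT : finGroupType) (p : nat).
Implicit Types (A B D E G : {group gT}).

(* Quillen's contraction A <= A C_Z(A) >= C_Z(A) <= Z, where Z is a normal
   elementary abelian p-subgroup; it is not monotone, hence the comparison
   through A C_Z(B) in the proof. *)
Lemma Ap_pcore_trivial G :
  prime p -> 'O_p(G) != 1 -> cocycle_trivial subgroup_rel (Ap p G).
Proof.
move=> p_pr ntO H c; set P := Ap p G => coc.
have cc A B D : A \in P -> B \in P -> D \in P -> A \subset B -> B \subset D ->
  c A D = c A B * c B D := coc A B D.
pose Z := 'Ohm_1('Z('O_p(G)))%G.
have pO : p.-group 'O_p(G) := pcore_pgroup p G.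
have abelZ : p.-abelem Z.
  by apply: Ohm1_abelem; rewrite ?center_abelian // (pgroupS (center_sub _)).
have ntZ : Z :!=: 1.
  by rewrite Ohm1_eq1 (contraNneq _ ntO) // => /(trivg_center_pgroup pO)/eqP.
have nsZG : Z <| G.
  apply: char_normal_trans (pcore_normal p G).
  exact: char_trans (Ohm_char 1 _) (center_char _).
have [sZG nZG] := andP nsZG.
pose C (A : {group gT}) := 'C_Z(A)%G.
have CP A : A \in P -> C A \in P.
  case/ApP=> sAG abelA _; apply/ApP; split=> /=.
  - by rewrite subIset // sZG.
  - by apply: abelemS abelZ; exact: subsetIl.
  have pA := abelem_pgroup abelA; have pZ := abelem_pgroup abelZ.
  have nZA : A \subset 'N(Z) := subset_trans sAG nZG.
  (* A nontrivial normal subgroup of a [p]-group meets its center; this is why [C A] is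
     nontrivial. *)
  have pZA : p.-group (Z <*> A) by rewrite norm_joinEr // pgroupM pZ pA.
  have nsZ : Z <| Z <*> A by rewrite normalYl.
  have := meet_center_nil (pgroup_nil pZA) nsZ ntZ.
  apply: contraNneq => C1; rewrite -subG1 -C1.
  rewrite subsetI subsetIl /= (subset_trans (subsetIr _ _)) //.
  by rewrite (subset_trans (subsetIr _ _)) // centS // joing_subr.
have ZP : Z \in P by apply/ApP.
have joinP A B : A \in P -> B \in P -> B \subset 'C(A) -> (A <*> B)%G \in P.
  move=> /ApP[sAG abelA ntA] /ApP[sBG abelB _] cAB; apply/ApP; split.
  - by rewrite join_subG sAG.
  - by rewrite /= (cprod_abelem p (cprodEY cAB)) abelA.
  - by apply: contraNneq ntA => AB1; rewrite -subG1 -AB1 joing_subl.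
have cC A : C A \subset 'C(A) by exact: subsetIr.
(* Going up to a common upper bound and down again gives the same result for two comparable
   bounds. *)
have ideal u v L M : u \in P -> v \in P -> L \in P -> M \in P ->
    u \subset L -> v \subset L -> L \subset M ->
    c u M * (c v M)^-1 = c u L * (c v L)^-1.
  move=> uP vP LP MP uL vL LM; rewrite (cc u L M) // (cc v L M) //.
  by rewrite invgM !mulgA mulgK.
(* Transport from [A] to the fixed vertex [Z] along the contraction; the potential is its
   inverse. *)
pose m A := c A (A <*> C A)%G * (c (C A) (A <*> C A)%G)^-1 * c (C A) Z.
exists (fun A => (m A)^-1) => A B AP BP sAB; rewrite invgK.
apply: (mulIg (m B)); rewrite mulgVK.
have [CA CB] := (CP A AP, CP B BP).
have sCBA : C B \subset C A by rewrite setIS // centS.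
have sCZ E : C E \subset Z by exact: subsetIl.
have EP : (A <*> C B)%G \in P by apply: joinP; rewrite // (subset_trans sCBA).
have ACP : (A <*> C A)%G \in P by exact: joinP.
have BCP : (B <*> C B)%G \in P by exact: joinP.
pose mid := c A (A <*> C B)%G * (c (C B) (A <*> C B)%G)^-1 * c (C B) Z.
have -> : m A = mid.
  rewrite /m (_ : c A _ * _ = c A (A <*> C B)%G * (c (C B) (A <*> C B)%G)^-1 *
    c (C B) (C A)); last first.
    rewrite -(ideal _ _ _ (A <*> C A)%G) ?joing_subl ?joing_subr //; last first.
      by rewrite join_subG joing_subl (subset_trans sCBA) ?joing_subr.
    rewrite (cc (C B) (C A) (A <*> C A)%G) ?joing_subr //.
    by rewrite invgM !mulgA mulgVK.
  by rewrite /mid (cc (C B) (C A) Z) // mulgA.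
rewrite /m !mulgA -(cc A B (B <*> C B)%G) ?joing_subl // /mid.
rewrite (ideal _ _ (A <*> C B)%G (B <*> C B)%G) ?joing_subl ?joing_subr //.
by rewrite join_subG joing_subr (subset_trans sAB) ?joing_subl.
Qed.

End Pcore.

(** * Passing to the quotient by a normal p'-subgroup *)

Section Quotient.
Variables (gT : finGroupType) (p : nat) (G N : {group gT}).
Hypotheses (p'N : p^'.-group N) (nsNG : N <| G).
Implicit Types (A B E : {group gT}).

Let nNG : G \subset 'N(N). Proof. exact: normal_norm. Qed.

Lemma Ap_norm A : A \in Ap p G -> A \subset 'N(N).
Proof. by case/ApP=> sAG _ _; exact: subset_trans nNG. Qed.

Lemma Ap_TI A : A \in Ap p G -> N :&: A = 1.
Proof.
case/ApP=> _ /abelem_pgroup pA _.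
by apply: coprime_TIg; rewrite coprime_sym (pnat_coprime pA).
Qed.

Lemma card_Ap_quotient A : A \in Ap p G -> #|A / N| = #|A|.
Proof.
by move=> AP; rewrite -(card_isog (quotient_isog (Ap_norm AP) (Ap_TI AP))).
Qed.

Lemma quotient_Ap A : A \in Ap p G -> (A / N)%G \in Ap p (G / N).
Proof.
move=> AP; have /ApP[sAG abelA ntA] := AP; apply/ApP; split.
- exact: quotientS.
- exact: quotient_abelem.
by rewrite -cardG_gt1 card_Ap_quotient // cardG_gt1.
Qed.

Lemma Ap_quotient_inj A B : A \in Ap p G -> B \in Ap p G -> A \subset B ->
  (A / N)%G = (B / N)%G -> A = B.
Proof.
move=> AP BP sAB AB; apply/val_inj/eqP; rewrite eqEcard sAB /=.
by rewrite -(card_Ap_quotient AP) -(card_Ap_quotient BP) [A / N](congr1 val AB).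
Qed.

(** A Sylow [p]-subgroup of the preimage of [B] maps isomorphically onto [B], since the kernel is a
    [p']-group. *)
Lemma Ap_lift (B : {group coset_of N}) : B \in Ap p (G / N) ->
  exists2 A, A \in Ap p G & (A / N)%G = B.
Proof.
case/ApP=> sBG abelB ntB.
have [K defB sNK sKG] := inv_quotientS nsNG sBG.
have [A sylA] := Sylow_exists p K.
have nNK : K \subset 'N(N) := subset_trans sKG nNG.
have sAK := pHall_sub sylA; have nNA := subset_trans sAK nNK.
have tiNA : N :&: A = 1.
  by apply: coprime_TIg; rewrite coprime_sym (pnat_coprime (pHall_pgroup sylA)).
have AB : A / N = B.
  rewrite defB; apply: pHall_id (quotient_pHall nNA sylA) _.
  by rewrite /= -defB abelem_pgroup.
exists A; last exact/val_inj.
apply/ApP; split; first exact: subset_trans sKG.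
  by rewrite (isog_abelem (quotient_isog nNA tiNA)) /= AB.
by apply: contraNneq ntB => A1; rewrite -AB A1 quotient1.
Qed.

Lemma Ap_fibre A : A \in Ap p G ->
  poset_fibre subgroup_rel (Ap p G) (fun E => (E / N)%G) (A / N)%G =
  Ap p (N <*> A).
Proof.
move=> AP; have nNA := Ap_norm AP; apply/setP => E; rewrite inE.
have /ApP[sAG _ _] := AP.
have sNAG : N <*> A \subset G by rewrite join_subG normal_sub.
apply/andP/idP => [[EP]|EP].
  rewrite /subgroup_rel /= quotientSK ?(Ap_norm EP) // -norm_joinEr // => sE.
  by case/ApP: EP => _ abelE ntE; apply/ApP.
have /ApP[sE abelE ntE] := EP.
have EG : E \in Ap p G by apply/ApP; split=> //; exact: subset_trans sNAG.
by rewrite EG /subgroup_rel /= quotientSK ?(Ap_norm EG) // -norm_joinEr.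
Qed.

Lemma quotient_coboundary :
    (forall A, A \in Ap p G -> 2 < logn p #|A| ->
       cocycle_trivial subgroup_rel (Ap p (N <*> A))) ->
    cocycle_trivial subgroup_rel (Ap p (G / N)) ->
  forall (H : groupType) (c : {group gT} -> {group gT} -> H),
    poset_cocycle subgroup_rel (Ap p G) c ->
    coboundary subgroup_rel (nonminimal subgroup_rel (Ap p G)) c.
Proof.
move=> fib_triv base_triv H c.
apply: (fibre_coboundary (@subgroup_rel_refl gT) (@subgroup_rel_refl _)
  (@subgroup_rel_trans _) (Q := Ap p (G / N)) (f := fun E => (E / N)%G)).
- exact: quotient_Ap.
- by move=> A B _ _; exact: quotientS.
- exact: Ap_quotient_inj.
- move=> B /Ap_lift[A AP <-]; exists A.
  by rewrite inE AP /=; exact: subgroup_rel_refl.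
- move=> B BN; have BQ : B \in Ap p (G / N).
    by move: BN; rewrite inE => /andP[].
  have [A AP defB] := Ap_lift BQ; have := Ap_nonminimal_gt1 BN.
  rewrite -defB Ap_fibre //= card_Ap_quotient //.
  by case/ApP: (AP) => _ abelA _; apply: Ap_connected => //; exact: Ap_norm.
- move=> B D BN DQ nBD sBD; have [A AP defD] := Ap_lift DQ.
  rewrite -defD Ap_fibre //; apply: fib_triv => //.
  (* [B] is nonminimal, hence of rank at least 2, and [D] is strictly larger. *)
  rewrite -card_Ap_quotient // -[A / N]/(gval (A / N)%G) defD.
  apply: leq_ltn_trans (Ap_nonminimal_gt1 BN) _; rewrite ltnNge.
  apply: contra nBD => leDB; case/ApP: DQ => _ abelD _.
  by apply/eqP/val_inj; exact: abelem_logn_sub abelD sBD leDB.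
- exact: base_triv.
Qed.

End Quotient.

(** * Minimal normal subgroups and the generalized Fitting subgroup *)

Lemma minnormal_TI (gT : finGroupType) (L M N : {group gT}) :
  minnormal L N -> minnormal M N -> L :&: M = 1 \/ L :=: M.
Proof.
move=> /mingroupP[/andP[ntL nLN] minL] /mingroupP[/andP[ntM nMN] minM].
have [|ntI] := eqVneq (L :&: M) 1; [by left | right].
have nI : (L :&: M != 1) && (N \subset 'N(L :&: M)) by rewrite ntI normsI.
have eL := minL (L :&: M)%G nI (subsetIl _ _).
have eM := minM (L :&: M)%G nI (subsetIr _ _).
by rewrite -[LHS]eL -[RHS]eM.
Qed.

Lemma minnormal_conj (gT : finGroupType) (L N : {group gT}) x :
  x \in 'N(N) -> minnormal L N -> minnormal (L :^ x)%G N.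
Proof.
move=> Nx /mingroupP[/andP[ntL nLN] minL]; apply/mingroupP; split.
  by rewrite /= -(conjs1g x) (inj_eq (@conjsg_inj _ x)) ntL normJ
    -{1}(normP Nx) conjSg.
move=> H /andP[ntH nHN] sHL.
have HL : H :^ x^-1 = L.
  apply: (minL (H :^ x^-1)%G); last by rewrite /= sub_conjgV.
  rewrite /= -(conjs1g x^-1) (inj_eq (@conjsg_inj _ x^-1)) ntH normJ.
  by rewrite -{1}(normP (groupVr Nx)) conjSg.
by rewrite /= -HL conjsgKV.
Qed.

Section MinimalNormal.
Variables (gT : finGroupType) (p : nat) (N A L : {group gT}).
Hypotheses (p'N : p^'.-group N) (pA : p.-group A) (cAA : abelian A).
Hypotheses (minN : minnormal N (N <*> A)) (ncN : ~~ abelian N).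
Hypotheses (minL : minnormal L N) (sLN : L \subset N).
Hypothesis cANA : 'C_A(N) = 1.

Local Notation G := (N <*> A).

Let nNG : G \subset 'N(N).
Proof. by case/mingroupP: minN => /andP[]. Qed.

Let nNA : A \subset 'N(N).
Proof. exact: subset_trans (joing_subr _ _) nNG. Qed.

Let minLx x : x \in A -> minnormal (L :^ x)%G N.
Proof. by move=> Ax; apply: minnormal_conj minL; exact: subsetP Ax. Qed.

Let sLxN x : x \in A -> L :^ x \subset N.
Proof. by move=> Ax; rewrite -(normsP nNA x Ax) conjSg. Qed.

Let nLxN x : x \in A -> N \subset 'N(L :^ x).
Proof. by move=> /minLx/mingroupP[/andP[]]. Qed.

Let conj_cent x y : x \in A -> y \in A ->
  L :^ x = L :^ y \/ L :^ x \subset 'C(L :^ y).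
Proof.
move=> Ax Ay; have [TI|->] := minnormal_TI (minLx Ax) (minLx Ay).
  right; apply/commG1P/trivgP; rewrite -TI; apply: commg_subI.
    by rewrite subsetI subxx (subset_trans (sLxN Ax)) ?nLxN.
  by rewrite subsetI subxx (subset_trans (sLxN Ay)) ?nLxN.
by left.
Qed.

Let conj_gen : <<\bigcup_(H in L :^: A) H>> = N.
Proof.
set J := <<_>>.
have sJN : J \subset N.
  by rewrite gen_subG; apply/bigcupsP => _ /imsetP[x Ax ->]; exact: sLxN.
have nJ : G \subset 'N(J).
  rewrite join_subG; apply/andP; split; apply: norms_gen; apply/subsetP => y.
    move=> Ny; rewrite inE; apply/subsetP => _
      /imsetP[z /bigcupP[_ /imsetP[x Ax ->]] zLx ->].
    apply/bigcupP; exists (L :^ x); first exact: imset_f.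
    by rewrite memJ_norm // (subsetP (nLxN Ax)).
  move=> Ay; rewrite inE; apply/subsetP => _
    /imsetP[z /bigcupP[_ /imsetP[x Ax ->]] zLx ->].
  apply/bigcupP; exists (L :^ (x * y)); first by rewrite imset_f // groupM.
  by rewrite conjsgM memJ_conjg.
have sLJ : L \subset J.
  rewrite sub_gen // (bigcup_max (L :^ 1)) ?conjsg1 //.
  by apply/imsetP; exists 1; rewrite ?conjsg1.
case/mingroupP: minN => _ /(_ <<\bigcup_(H in L :^: A) H>>%G) minJ.
apply: minJ => //; rewrite nJ andbT; case/mingroupP: minL => /andP[+ _] _.
by apply: contraNneq => J1; rewrite -subG1 -J1.
Qed.

Lemma minnormal_nonabelian : ~~ abelian L.
Proof.
apply: contra ncN => cLL; rewrite -conj_gen abelian_gen.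
apply/bigcupsP => _ /imsetP[x Ax ->]; rewrite centsC.
apply/bigcupsP => _ /imsetP[y Ay ->].
by have [->|] := conj_cent Ay Ax; rewrite // -abelianE abelianJ.
Qed.

(** A normal subgroup of [L] is normalized by [L] and centralized by the other conjugates of [L].
    These generate [N], so minimality of [L] applies. *)
Lemma minnormal_simple : simple L.
Proof.
have [ntL _] : L :!=: 1 /\ true by case/mingroupP: minL => /andP[].
apply/simpleP; split=> // H /andP[sHL nHL].
have [->|ntH] := eqVneq (H : {set gT}) 1; [by left | right].
case/mingroupP: minL => _; apply=> //; rewrite ntH /=.
rewrite -conj_gen gen_subG; apply/bigcupsP => _ /imsetP[x Ax ->].
have := conj_cent Ax (group1 A); rewrite conjsg1 => -[-> //|cL].
by apply: subset_trans cL _; rewrite (subset_trans (centS sHL)) ?cent_sub.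
Qed.

Let center_conj1 x : 'Z(L :^ x) = 1.
Proof.
rewrite /center centJ -conjIg -/('Z(L)); suff -> : 'Z(L) = 1 by rewrite conjs1g.
case/simpleP: minnormal_simple => _ /(_ 'Z(L)%G (center_normal L))[//|/= ZL].
 case/negP: minnormal_nonabelian.
by rewrite -[X in abelian X]ZL center_abelian.
Qed.

(** The other conjugates centralize [L :^ x], so their product meets it inside its center, which is
    trivial. *)
Lemma minnormal_bigdprod : \big[dprod/1]_(H in L :^: A) H = N.
Proof.
pose F (H : {set gT}) := <<H>>%G.
have FE H : H \in L :^: A -> H = F H.
  by case/imsetP => x _ ->; rewrite /= genGid.
rewrite (eq_bigr _ FE) -[RHS]conj_gen.
have -> : <<\bigcup_(H in L :^: A) H>> = (\prod_(H in L :^: A) F H)%G.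
  by rewrite bigprodGE; congr <<_>>; exact: eq_bigr.
apply/eqP/bigdprodYP => _ /imsetP[x Ax ->]; rewrite bigprodGE subsetD.
set K := <<_>>.
have cKL : K \subset 'C(F (L :^ x)).
  rewrite gen_subG; apply/bigcupsP => H /andP[/imsetP[y Ay ->]] nyx.
  rewrite /= !genGid; have [e|//] := conj_cent Ay Ax.
  by rewrite e eqxx in nyx.
rewrite cKL; apply/pred0P => z /=; rewrite !inE; apply/negP.
case/and3P=> Kz ntz Fz; have : z \in 'Z(L :^ x).
  by move: Fz (subsetP cKL z Kz); rewrite /= !genGid => Fz cz; apply/setIP.
by rewrite center_conj1 inE (negPf ntz).
Qed.

Lemma minnormal_component x : x \in A -> component (L :^ x)%G G.
Proof.
move=> Ax; apply/andP; split.
  apply: (@subnormal_trans _ N); apply: normal_subnormal.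
    by rewrite /normal sLxN // nLxN.
  by rewrite /normal joing_subl.
have simLx : simple (L :^ x).
  by rewrite -(isog_simple (conj_isog L x)) minnormal_simple.
apply/andP; split; last first.
  by rewrite center_conj1 -(isog_simple (quotient1_isog _)).
case/simpleP: simLx => _ /(_ (L :^ x)^`(1)%G (der_normal 1 _))[]/= e.
  case/negP: minnormal_nonabelian; rewrite -(abelianJ _ x).
  by apply/commG1P.
by rewrite e.
Qed.

(** By minimality the Fitting subgroup meets [N] in 1 or [N], and [N] would then be nilpotent, hence
    abelian. So it centralizes [N] and embeds in [G / N]; being a normal [p]-subgroup it lies in
    [A], hence in ['C_A(N)]. *)
Lemma minnormal_Fitting1 : 'F(G) = 1.
Proof.
set F := 'F(G)%G; have nsFG : F <| G := Fitting_normal _.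
have FN1 : F :&: N = 1.
  apply/eqP; apply: contraNT ncN => ntFN.
  have FN : F :&: N = N.
    case/mingroupP: minN => _ /(_ (F :&: N)%G); apply; last exact: subsetIr.
    by rewrite ntFN normsI // normal_norm.
  have nilN : nilpotent N.
    by rewrite -FN; apply: nilpotentS (Fitting_nil G); exact: subsetIl.
  have ntN : N :!=: 1 by case/mingroupP: minN => /andP[].
  have ZN : 'Z(N) = N.
    case/mingroupP: minN => _ /(_ 'Z(N)%G); apply; last exact: center_sub.
    by rewrite /= center_nil_eq1 // ntN (char_norm_trans (center_char N)).
  by rewrite -ZN center_abelian.
have cFN : F \subset 'C(N).
  apply/commG1P/trivgP; rewrite -FN1; apply: commg_subI.
    by rewrite subsetI subxx (subset_trans (normal_sub nsFG)).
  by rewrite subsetI subxx (subset_trans _ (normal_norm nsFG)) ?joing_subl.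
have nNF : F \subset 'N(N) := subset_trans (normal_sub nsFG) nNG.
have pF : p.-group F.
  have -> : p.-group F = p.-group (F / N).
    by rewrite /pgroup (card_isog (quotient_isog nNF _)) // setIC.
  apply: pgroupS (quotientS N (normal_sub nsFG)) _.
  by rewrite /= quotientYidl // quotient_pgroup.
have [n Nn sFA] := pgroup_sub_conj pA p'N nNA pF (normal_sub nsFG).
apply/trivgP; rewrite -cANA subsetI cFN andbT.
have Gn : n \in G by rewrite mem_gen // inE Nn.
by rewrite -(conjSg _ _ n) (normsP (normal_norm nsFG)).
Qed.

(** Every component is perfect, hence lies in [N] because [G / N] is abelian; conversely the
    conjugates of [L] are components generating [N]. *)
Lemma minnormal_gen_Fitting : gen_Fitting G = N.
Proof.
rewrite /gen_Fitting minnormal_Fitting1.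
apply/eqP; rewrite eqEsubset; apply/andP; split.
  rewrite gen_subG subUset sub1G; apply/bigcupsP => M.
  move=> /andP[/subnormal_sub sMG /andP[/eqP defM _]].
  rewrite -defM; apply: subset_trans (der1_min nNG _).
    exact: dergS.
  by rewrite /= quotientYidl // quotient_abelian.
rewrite -{1}conj_gen genS // subsetU //; apply/orP; right.
apply/bigcupsP => _ /imsetP[x Ax ->].
exact: (bigcup_max (L :^ x)%G (minnormal_component Ax)).
Qed.

End MinimalNormal.

(** * Induction down to the case of the conjecture *)

Section Reduction.
Variables (R : realType) (p : nat).
Hypotheses (p_pr : prime p) (aschbacher : aschbacher_conjecture R p).

Theorem Ap_coprime_trivial (gT : finGroupType) (N A : {group gT}) :
    p^'.-group N -> A \subset 'N(N) -> p.-abelem A -> 2 < logn p #|A| ->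
  cocycle_trivial subgroup_rel (Ap p (N <*> A)).
Proof.
have [n] := ubnP #|N|; elim: n => // n IH in gT N A *; rewrite ltnS => leNn.
move=> p'N nNA abelA ltA; pose G := (N <*> A)%G.
have pA := abelem_pgroup abelA; have cAA := abelem_abelian abelA.
have [sNG sAG] : N \subset G /\ A \subset G by rewrite joing_subl joing_subr.
have ncA : ~~ cyclic A by rewrite (abelem_cyclic abelA) -ltnNge ltnW.
have ntA : A :!=: 1 by apply: contraNneq ncA => ->; rewrite cyclic1.
have nsNG : N <| G by rewrite /normal sNG join_subG normG.
have coNA : coprime #|N| #|A| by rewrite coprime_sym (pnat_coprime pA).
(* Both [N] and the abelian group [A] centralize ['C_A(N)], so it is a normal [p]-subgroup of [G];
   if nontrivial, the contraction applies. *)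
have [cANA|ntC] := eqVneq 'C_A(N) 1; last first.
  apply: Ap_pcore_trivial p_pr _; apply: contraNneq ntC => O1.
  rewrite -subG1 -O1; apply: pcore_max; first exact: pgroupS (subsetIl _ _) pA.
  rewrite /normal subIset ?sAG //= join_subG; apply/andP; split.
    by rewrite cents_norm // centsC subsetIr.
  by rewrite cents_norm // (subset_trans cAA) // centS // subsetIl.
(* For a proper [M] the induction hypothesis serves twice: for [M] on the fibres, and for [N / M] on
   the base. *)
have [minN|nminN] := boolP (minnormal N G); last first.
  have ntN : N :!=: 1.
    apply: contraNneq ntA => N1; rewrite -subG1 -cANA subsetI subxx N1.
    by rewrite cents1.
  have [M minM sMN] := minnormal_exists ntN (normal_norm nsNG).
  have nMG : G \subset 'N(M) by case/mingroupP: minM => /andP[].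
  have ntM : M :!=: 1 by case/mingroupP: minM => /andP[].
  have nsMG : M <| G by rewrite /normal (subset_trans sMN).
  have neMN : M :!=: N by apply: contraNneq nminN => <-.
  have ltMN : #|M| < #|N|.
    by rewrite proper_card // properEneq neMN.
  have p'M := pgroupS sMN p'N.
  have [nMN nMA] := (subset_trans sNG nMG, subset_trans sAG nMG).
  have tiMA : M :&: A = 1 by apply: coprime_TIg; exact: coprimeSg coNA.
  move=> H c cc; apply: (coboundary_links (@subgroup_rel_refl _) cc).
    apply: (quotient_coboundary p'M nsMG) => //.
      move=> B BP ltB; have /ApP[sBG abelB _] := BP.
      by apply: IH; rewrite ?(leq_trans ltMN) // (subset_trans sBG).
    have -> : (G / M)%G = ((N / M) <*> (A / M))%G.
      by apply/val_inj; rewrite /= quotientY.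
    apply: IH.
    - by apply: leq_trans leNn; exact: ltn_quotient.
    - exact: quotient_pgroup.
    - exact: quotient_norms.
    - exact: quotient_abelem.
    - by rewrite -(card_isog (quotient_isog nMA tiMA)).
  (* The minimal [D] has rank at most 1 and [A] rank at least 3, which leaves the gap of two that
     connected links require. *)
  move=> D DP nD; apply: Ap_upper_link_connected => //.
  by apply: leq_trans ltA; rewrite !ltnS (Ap_minimal_le1 DP).
(* If [N] were abelian, each ['C_N[a]] would be normal in [G], so 1 or [N]. The latter contradicts
   ['C_A(N) = 1], and if all are 1, coprime generation gives [N = 1]. *)
have ncN : ~~ abelian N.
  have ntN : N :!=: 1 by case/mingroupP: minN => /andP[].
  apply: contra ntN => cNN; rewrite -subG1.
  apply: (coprime_cent1_gen (M := 1%G) cAA ncA nNA coNA) => a /setD1P[nta Aa].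
  apply: contraR nta; rewrite subG1 => ntCa.
  suff CaN : 'C_N[a] = N.
    have : a \in 'C_A(N).
      by rewrite inE Aa -sub_cent1; rewrite -{1}CaN subsetIr.
    by rewrite cANA inE.
  case/mingroupP: minN => _ /(_ 'C_N[a]%G); apply; last exact: subsetIl.
  rewrite ntCa /= join_subG; apply/andP; split.
    by rewrite cents_norm // (subset_trans cNN) // centS // subsetIl.
  by rewrite normsI // (subset_trans _ (normG _)) // sub_cent1 (subsetP cAA).
have ntN : N :!=: 1 by case/mingroupP: minN => /andP[].
have [L minL sLN] := minnormal_exists ntN (normG N).
have defF := minnormal_gen_Fitting p'N pA cAA minN ncN minL sLN cANA.
have compL := minnormal_component minN ncN minL sLN (group1 A).
apply: (@simply_connected_trivial _ _ (@subgroup_rel_refl _)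
  (@subgroup_rel_anti _) (@subgroup_rel_trans _) R).
apply: (aschbacher (A := A) (L := L)) => //.
- by rewrite (rank_abelem abelA).
- have <- : (L :^ 1)%G = L by apply/val_inj; exact: conjsg1.
  exact: compL.
- exact: (minnormal_simple minN minL sLN).
- exact: (minnormal_nonabelian minN ncN minL sLN).
- by rewrite prime_coprime // -p'natE //; exact: pgroupS p'N.
- by rewrite defF; exact: (minnormal_bigdprod minN ncN minL sLN).
- by rewrite defF -norm_joinEl // joingC.
Qed.

End Reduction.

(** * The subgroup generated by elements of order p, and p-solvable groups *)

Section PSolvable.
Variables (gT : finGroupType) (p : nat).
Implicit Types (G H K N Q : {group gT}).

Lemma Omega1_sub G : Omega1 p G \subset G.
Proof. by rewrite gen_subG subsetIl. Qed.

Lemma Ap_Omega1 G : Ap p (Omega1_group p G) = Ap p G.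
Proof.
apply/setP => A; apply/ApP/ApP => -[sA abelA ntA]; split=> //.
  exact: subset_trans (Omega1_sub G).
apply/subsetP => x Ax; rewrite mem_gen // !inE (subsetP sA) //=.
have [p_pr _ _] := pgroup_pdiv (abelem_pgroup abelA) ntA.
by have /(abelemP p_pr)[_ ->] := abelA.
Qed.

Lemma pcore1_normal (aT : finGroupType) (pi : nat_pred) (H K : {group aT}) :
  H <| K -> 'O_pi(K) = 1 -> 'O_pi(H) = 1.
Proof.
move=> nsHK O1; apply/trivgP; rewrite -O1.
apply: pcore_max (pcore_pgroup _ _) _.
exact: char_normal_trans (pcore_char _ _) nsHK.
Qed.

Lemma pgroup_section (pi : nat_pred) (H K X N : {group gT}) :
    K <| H -> X \subset H -> X \subset 'N(N) -> X :&: K \subset N ->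
  pi.-group (H / K) -> pi.-group (X / N).
Proof.
move=> /andP[sKH nKH] sXH nNX sXKN; have nKX := subset_trans sXH nKH.
have : pi.-group (H / K) -> pi.-group (X / K) := pgroupS (quotientS K sXH).
move=> piS /piS; rewrite /pgroup !card_quotient // => piX.
apply: pnat_dvd piX; rewrite -(indexgI X N) -(indexgI X K).
have sXKXN : X :&: K \subset X :&: N by rewrite subsetI subsetIl.
by rewrite -(Lagrange_index (subsetIl X N) sXKXN) dvdn_mulr.
Qed.

(** The series of [G] is intersected with [Q]. Cores of normal subgroups of [Q / N] stay trivial, so
    induction puts [Q :&: H] inside [N]; then [Q / N] is a [p]- or [p']-group and equals one of its
    own trivial cores. *)
Lemma p_solvable_pcores_neq1 G Q N :
    p_solvable p G -> Q \subset G -> Q \subset 'N(N) ->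
    'O_p(Q / N) = 1 -> 'O_p^'(Q / N) = 1 ->
  Q \subset N.
Proof.
case=> s; elim: s G Q => [|H s IH] G Q /=.
  by move=> -> _ sQ _ _ _; rewrite (subset_trans sQ) ?sub1G.
move=> lastH /andP[/andP[nsHG piGH] pathH] sQG nNQ Op1 Op'1.
have nsQH : Q :&: H <| Q := normalGI sQG nsHG.
have nsQHN : (Q :&: H) / N <| Q / N by exact: quotient_normal.
have sQHN : Q :&: H \subset N.
  apply: (IH H (Q :&: H)%G) => //.
  - exact: subsetIr.
  - exact: subset_trans (subsetIl _ _) nNQ.
  - exact: pcore1_normal nsQHN Op1.
  - exact: pcore1_normal nsQHN Op'1.
by case/orP: piGH => /(pgroup_section nsHG sQG nNQ sQHN) piQ;
  rewrite -quotient_sub1 // -(pcore_pgroup_id piQ) ?Op1 ?Op'1.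
Qed.

End PSolvable.

Theorem corollary1p1 (R : realType) (gT : finGroupType) (G : {group gT})
    (p : nat) (p_prime : prime p) (p_dvd_G : p %| #|G|)
    (aschbacher : aschbacher_conjecture R p) :
  ('O_p^'(Omega1 p G) \proper 'O_{p^',p}(Omega1 p G) ->
    forall x : Ap_space R p G, free_group (fundamental_group R x))
  /\
  (p_solvable p G ->
    forall x : Ap_space R p G, free_group (fundamental_group R x)).
Proof.
set W := Omega1_group p G.
have main : 'O_p^'(W) \proper 'O_{p^',p}(W) ->
    forall x : Ap_space R p G, free_group (fundamental_group R x).
  move=> prW x; pose N := 'O_p^'(W)%G.
  have p'N : p^'.-group N := pcore_pgroup _ _.
  have nsNW : N <| W := pcore_normal _ _.
  apply: (free_fundamental_group_poset (@subgroup_rel_refl gT)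
    (@subgroup_rel_anti gT) (@subgroup_rel_trans gT)) => H c.
  rewrite -Ap_Omega1; apply: (quotient_coboundary p'N nsNW).
    move=> A AP ltA; have /ApP[_ abelA _] := AP.
    apply: (Ap_coprime_trivial p_prime aschbacher) => //.
    exact: Ap_norm nsNW _ AP.
  (* The image of ['O_{p^',p}(W)] in [W / N] is ['O_p(W / N)], so the proper inclusion makes it
     nontrivial. *)
  apply: (Ap_pcore_trivial p_prime); rewrite -quotient_pseries2.
  rewrite quotient_neq1 //; apply: normalS nsNW; first exact: proper_sub.
  exact: pseries_sub.
split=> // psG; apply: main.
have nsN2 : 'O_p^'(W) <| 'O_{p^',p}(W).
  apply: normalS (pcore_normal _ _); last exact: pseries_sub.
  by have := pseries_sub_catl [:: p^' : nat_pred] [:: p : nat_pred] W;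
    rewrite pseries1.
rewrite -quotient_neq1 // quotient_pseries2; apply/negP => /eqP Op1.
(* Without the proper inclusion both cores of the quotient are trivial, so [W] would be a
   [p']-group; yet it contains the elements of order [p] given by Cauchy. *)
have sWN : W \subset 'O_p^'(W).
  apply: (p_solvable_pcores_neq1 psG (Omega1_sub p G)) => //.
    exact: gFnorm.
  exact: trivg_pcore_quotient.
have [x Gx ox] := Cauchy p_prime p_dvd_G.
have Wx : x \in W by rewrite mem_gen // !inE Gx -ox expg_order eqxx.
have := pgroupS sWN (pcore_pgroup p^' W).
move/(mem_p_elt (x := x))/(_ Wx); rewrite /p_elt ox p'natE // dvdnn.
by [].
Qed.
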